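(* Let $n \ge 1$ and let $\mathcal S$ be a semigroup which is faithfully represented in $\mathcal M_n(\mathbb{ST})$, i.e. for which there exists an injective semigroup homomorphism $\rho:\mathcal S\to\mathcal M_n(\mathbb{ST})$. Then $\mathcal S$ satisfies a nontrivial semigroup identity.
   Context: **Supertropical semiring.** $\mathbb{ST}=\mathbb R\cup\{-\infty\}\cup\mathbb R^\nu$ is the disjoint union of two copies of $\mathbb R$ together with the zero element $-\infty$; elements of $\mathbb R^\nu$ are written $a^\nu$, $a\in\mathbb R$. The map $\nu:\mathbb{ST}\to\mathbb R^\nu\cup\{-\infty\}$ is given by $\nu(a)=\nu(a^\nu)=a^\nu$ for $a\in\mathbb R$ and $\nu(-\infty)=-\infty$. The total order is $-\infty<a<a^\nu<b<b^\nu$ for all real $a<b$. Addition: $x\vee y=\max\{x,y\}$ if $\nu(x)\neq\nu(y)$, and $x\vee y=\nu(x)$ if $\nu(x)=\nu(y)$. Multiplication: $x\cdot y$ is the usual sum $x+y$ if $x,y\in\mathbb R$; otherwise it is the sum of $\nu(x)$ and $\nu(y)$, where $a^\nu+b^\nu=(a+b)^\nu$ and $-\infty$ is absorbing. The multiplicative identity is $0\in\mathbb R$. $\mathcal M_n(\mathbb{ST})$ is the multiplicative monoid of $n\times n$ matrices over $\mathbb{ST}$. **Identities.** $\{a,b\}^+$ is the free semigroup of nonempty words in $a,b$. A nontrivial semigroup identity is a pair $\langle u,v\rangle$ of words $u\ne v$ in $\{a,b\}^+$. A semigroup $\mathcal S$ satisfies it if $\phi(u)=\phi(v)$ for every semigroup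 homomorphism $\phi:\{a,b\}^+\to\mathcal S$, i.e. if for all $s,t\in\mathcal S$ the substitution $a\mapsto s$, $b\mapsto t$ gives $u$ and $v$ the same value in $\mathcal S$. *)

(* Defs.v *)
From HB Require Import structures.
From mathcomp Require Import all_boot all_order all_algebra.
Set Implicit Arguments.
Unset Strict Implicit.
Unset Printing Implicit Defensive.

Import Order.TTheory GRing.Theory Num.Theory.

(* [Tangible a] is the real number a and [Ghost a] is its copy a^nu. *)
Inductive supertropical (R : Type) : Type :=
  | NegInf
  | Tangible of R
  | Ghost of R.

Arguments NegInf {R}.

Definition supertropical_code (R : Type) (x : supertropical R) :
    option (R + R) :=
  match x with
  | NegInf => None
  | Tangible a => Some (inl a)
  | Ghost a => Some (inr a)
  end.

Definition supertropical_decode (R : Type) (c : option (R + R)) :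
    supertropical R :=
  match c with
  | None => NegInf
  | Some (inl a) => Tangible a
  | Some (inr a) => Ghost a
  end.

Lemma supertropical_codeK (R : Type) :
  cancel (@supertropical_code R) (@supertropical_decode R).
Proof. by case. Qed.

HB.instance Definition _ (R : eqType) :=
  Equality.copy (supertropical R) (can_type (@supertropical_codeK R)).
HB.instance Definition _ (R : choiceType) :=
  Choice.copy (supertropical R) (can_type (@supertropical_codeK R)).

Fact supertropical_display : Order.disp_t. Proof. exact: Order.Disp tt tt. Qed.

Section SupertropicalOrder.
Variable R : realDomainType.
Implicit Types x y z : supertropical R.

(* The order -oo < a < a^nu < b < b^nu, for all a < b in R. *)
Definition supertropical_le x y : bool :=
  match x, y with
  | NegInf, _ => true
  | _, NegInf => false
  | Ghost a, Tangible b => (a < b)%R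
  | Tangible a, Tangible b | Tangible a, Ghost b | Ghost a, Ghost b =>
      (a <= b)%R
  end.

Lemma supertropical_le_anti : antisymmetric supertropical_le.
Proof.
case=> [|a|a] [|b|b] //=.
- by move/le_anti->.
- by case/andP=> ab ba; have := le_lt_trans ab ba; rewrite ltxx.
- by case/andP=> ab ba; have := lt_le_trans ab ba; rewrite ltxx.
- by move/le_anti->.
Qed.

Lemma supertropical_le_trans : transitive supertropical_le.
Proof.
case=> [|b|b] [|a|a] [|c|c] //=; try exact: le_trans.
- exact: lt_le_trans.
- by move=> ab bc; apply/ltW/(lt_le_trans ab bc).
- by move=> ab bc; apply/ltW/(le_lt_trans ab bc).
- exact: le_lt_trans.
Qed.

Lemma supertropical_le_total : total supertropical_le.
Proof.
case=> [|a|a] [|b|b] //=; try exact: le_total.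
- by case: leP.
- by case: ltP.
Qed.

HB.instance Definition _ := Order.isOrder.Build supertropical_display
  (supertropical R) (fun _ _ => erefl) (fun _ _ => erefl) (fun _ _ => erefl)
  supertropical_le_anti supertropical_le_trans supertropical_le_total.

End SupertropicalOrder.

Section SupertropicalSemiring.
Variable R : realDomainType.
Implicit Types x y z : supertropical R.

Definition nu x : supertropical R :=
  match x with
  | NegInf => NegInf
  | Tangible a | Ghost a => Ghost a
  end.

Definition supertropical_add x y : supertropical R :=
  if nu x == nu y then nu x else Order.max x y.

Definition supertropical_mul x y : supertropical R :=
  match x, y with
  | NegInf, _ | _, NegInf => NegInf
  | Tangible a, Tangible b => Tangible (a + b)%R
  | Tangible a, Ghost b | Ghost a, Tangible b | Ghost a, Ghost b =>
      Ghost (a + b)%R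
  end.

Lemma supertropical_leE x y : (x <= y)%O = supertropical_le x y.
Proof. by []. Qed.

Lemma nu_nu x : nu (nu x) = nu x.
Proof. by case: x. Qed.

Lemma nu_lt x y : (nu x < nu y)%O -> (x < y)%O.
Proof.
rewrite !ltNge !supertropical_leE.
case: x y => [|a|a] [|b|b] //=; by rewrite -leNgt -ltNge; apply: ltW.
Qed.

Lemma supertropical_addE x y : supertropical_add x y =
  if (nu x < nu y)%O then y else if (nu y < nu x)%O then x else nu x.
Proof.
rewrite /supertropical_add; case: ltgtP => [/nu_lt xy|/nu_lt xy|//].
- exact: max_r (ltW xy).
- exact: max_l (ltW xy).
Qed.

Lemma supertropical_nuD x y :
  nu (supertropical_add x y) = Order.max (nu x) (nu y).
Proof.
by rewrite supertropical_addE; case: (ltgtP (nu x)) => //; rewrite nu_nu.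
Qed.

Fact supertropical_addC : commutative supertropical_add.
Proof. by move=> x y; rewrite !supertropical_addE; case: ltgtP. Qed.

Fact supertropical_addA : associative supertropical_add.
Proof.
move=> x y z.
rewrite [LHS]supertropical_addE [RHS]supertropical_addE !supertropical_nuD.
rewrite !supertropical_addE.
case: (ltgtP (nu x) (nu y)) => xy; case: (ltgtP (nu y) (nu z)) => yz;
  rewrite ?xy ?yz ?ltxx ?(lt_gtF xy) ?(lt_gtF yz) //.
- by rewrite (lt_trans xy yz).
- by rewrite (lt_gtF (lt_trans yz xy)) (lt_trans yz xy).
- by rewrite -yz xy (lt_gtF xy).
Qed.

Fact supertropical_add0x : left_id NegInf supertropical_add.
Proof. by case. Qed.

Fact supertropical_mulC : commutative supertropical_mul.
Proof. by case=> [|a|a] [|b|b] //=; rewrite addrC. Qed.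

Fact supertropical_mulA : associative supertropical_mul.
Proof. by case=> [|a|a] [|b|b] [|c|c] //=; rewrite addrA. Qed.

Fact supertropical_mul1x : left_id (Tangible 0%R) supertropical_mul.
Proof. by case=> [|a|a] //=; rewrite add0r. Qed.

Fact supertropical_mul0x : left_zero NegInf supertropical_mul.
Proof. by []. Qed.

Lemma nu_mul_lt x y z : x != NegInf ->
  (nu (supertropical_mul x y) < nu (supertropical_mul x z))%O
  = (nu y < nu z)%O.
Proof.
rewrite !ltNge !supertropical_leE.
by case: x y z => [|a|a] [|b|b] [|c|c] //= _; rewrite lerD2l.
Qed.

Fact supertropical_mulDl :
  left_distributive supertropical_mul supertropical_add.
Proof.
move=> y z x; rewrite ![supertropical_mul _ x]supertropical_mulC.
have [->//|x0] := eqVneq x NegInf.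
rewrite !supertropical_addE !nu_mul_lt //.
by case: ltgtP => // _; case: x y {x0} => [|a|a] [|b|b].
Qed.

Fact supertropical_oner_neq0 : Tangible 0%R != NegInf :> supertropical R.
Proof. by []. Qed.

HB.instance Definition _ := GRing.isNmodule.Build (supertropical R)
  supertropical_addA supertropical_addC supertropical_add0x.

HB.instance Definition _ := GRing.Nmodule_isComNzSemiRing.Build
  (supertropical R) supertropical_mulA supertropical_mulC supertropical_mul1x
  supertropical_mulDl supertropical_mul0x supertropical_oner_neq0.

End SupertropicalSemiring.

(* An alias of 'M[K]_n whose product in group_scope is matrix multiplication. *)
Definition matrix_monoid (K : pzSemiRingType) (n : nat) : Type := 'M[K]_n.

HB.instance Definition _ (K : pzSemiRingType) (n : nat) :=
  Choice.on (matrix_monoid K n).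
HB.instance Definition _ (K : pzSemiRingType) (n : nat) :=
  isMonoid.Build (matrix_monoid K n)
    (@mulmxA K n n n n) (@mul1mx K n n) (@mulmx1 K n n).

(* The free semigroup {a, b}^+, with the two letters encoded as booleans. *)
Record word := Word { word_seq :> seq bool; _ : word_seq != [::] }.

HB.instance Definition _ := [isSub for word_seq].
HB.instance Definition _ := [Choice of word by <:].

Lemma word_cat_subproof (u v : word) : word_seq u ++ word_seq v != [::].
Proof. by case: u => [[]]. Qed.

Definition word_cat (u v : word) : word := Word (word_cat_subproof u v).

Fact word_catA : associative word_cat.
Proof. by move=> u v w; apply/val_inj; rewrite /= catA. Qed.

HB.instance Definition _ := isSemigroup.Build word word_catA.

Definition satisfies_identity (S : semigroupType) (u v : word) : Prop :=
  forall phi : {multiplicative word -> S}, phi u = phi v.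

(* Main.v *)
Require Import Defs.
From HB Require Import structures.
From mathcomp Require Import all_boot all_order all_algebra fingroup perm reals.
From mathcomp Require Import zify ring.
From mathcomp Require boolp.

(** An entry of a product of max-plus matrices is the largest weight of a walk
    labelled by that product, so an identity says that two words always have
    equally heavy optimal walks.

    Supertropical matrices reduce to max-plus ones. A supertropical entry is
    its value together with the information whether the optimal walk is unique
    and has only tangible arcs. Uniqueness is visible in the largest total
    weight of two distinct walks with the same ends, and these totals are
    entries of a max-plus matrix of size n + n^2, whose states are one vertex
    (the two walks agree so far) or a pair of vertices (they have parted);
    [walk_pairsM] shows that this encoding respects products. An identity of
    max-plus matrices of size n + n^2 is therefore one of supertropical
    matrices of size n.

    Max-plus matrices of size m = n + 1 satisfy an identity by induction on m,
    through the dichotomy [power_factors_or_rigid]: for suitable exponents s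
    and N that depend on m only, either M^s is a product of an m x n and an
    n x m matrix, or Z = M^N is rigid, which means that at every vertex the
    loop of Z is strictly heavier, per step, than every other short closed
    walk. Indeed, if Z is not rigid at k, then no optimal walk of length s
    needs to be at k at half time: otherwise shift the walk in time, by moving
    copies of a closed walk of length N from one half into the other, where one
    that is no lighter is found; all shifted walks are at k at half time only if the
    walk returns to k after every N steps, and then some of these returns can
    be exchanged for the closed walk that contradicts rigidity.

    Let a and b be two matrices and take finitely many words in them. If the
    power c^s of one of these words factors through dimension n, then so does
    the product W of all these powers. By [prod_slide], an identity u = v of
    size n then yields W u(x W, y W) = W v(x W, y W) for all x and y. If no
    such power factors, then a^N, b^N and the N-th powers of short words in
    them are rigid. This forces the diagonal of such words to be the product of
    the diagonals of the letters ([word_diag_additive]), because optimal closed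
    walks at different vertices never meet. Closed parts of a walk can then be
    replaced by loops, so walks with at most n proper steps suffice. The two
    [twin] words p and q are built so that they cannot be told apart by walks
    with at most n proper steps; hence p(a^N, b^N) = q(a^N, b^N). With this
    common value for x and y the equation above holds as well, u and v having
    the same length. *)

Set Implicit Arguments.
Unset Strict Implicit.
Unset Printing Implicit Defensive.

Import Order.TTheory GRing.Theory Num.Theory.
Local Open Scope ring_scope.

(** * The max-plus semiring *)

(** A separate name keeps the max-plus instances off the type [option R]. *)
Definition trop (R : Type) : Type := option R.

HB.instance Definition _ (R : eqType) := Equality.on (trop R).
HB.instance Definition _ (R : choiceType) := Choice.on (trop R).

Fact trop_display : Order.disp_t. Proof. exact: Order.Disp tt tt. Qed.

Section Trop.
Variable R : realDomainType.
Implicit Types x y z t : trop R.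

Definition trop_le x y : bool :=
  match x, y with
  | None, _ => true
  | _, None => false
  | Some a, Some b => a <= b
  end.

Fact trop_le_anti : antisymmetric trop_le.
Proof. by case=> [a|] [b|] //= /le_anti ->. Qed.

Fact trop_le_trans : transitive trop_le.
Proof. by case=> [b|] [a|] [c|] //=; apply: le_trans. Qed.

Fact trop_le_total : total trop_le.
Proof. by case=> [a|] [b|] //=; apply: le_total. Qed.

HB.instance Definition _ := Order.isOrder.Build trop_display (trop R)
  (fun _ _ => erefl) (fun _ _ => erefl) (fun _ _ => erefl)
  trop_le_anti trop_le_trans trop_le_total.

Definition trop_mul x y : trop R :=
  match x, y with Some a, Some b => Some (a + b) | _, _ => None end.

Fact trop_max0x : left_id (None : trop R) Order.max.
Proof. by case=> [a|]. Qed.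

Fact trop_mulA : associative trop_mul.
Proof. by case=> [a|] [b|] [c|] //=; rewrite addrA. Qed.

Fact trop_mulC : commutative trop_mul.
Proof. by case=> [a|] [b|] //=; rewrite addrC. Qed.

Fact trop_mul1x : left_id (Some 0) trop_mul.
Proof. by case=> [a|] //=; rewrite add0r. Qed.

Fact trop_mul_mono z : {homo trop_mul^~ z : x y / (x <= y)%O}.
Proof.
by case: z => [c|] [a|] [b|] //= ab; rewrite [(_ <= _)%O]lerD2r.
Qed.

Fact trop_mulDl : left_distributive trop_mul Order.max.
Proof.
move=> x y z; have [xy|yx] := leP x y.
  by rewrite max_r // trop_mul_mono.
by rewrite max_l // trop_mul_mono // ltW.
Qed.

HB.instance Definition _ := GRing.isNmodule.Build (trop R)
  (@maxA _ (trop R)) (@maxC _ (trop R)) trop_max0x.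

HB.instance Definition _ := GRing.Nmodule_isComNzSemiRing.Build (trop R)
  trop_mulA trop_mulC trop_mul1x trop_mulDl (fun _ => erefl) isT.

Lemma trop_addE x y : x + y = Order.max x y. Proof. by []. Qed.

Lemma trop_ge0 x : ((0 : trop R) <= x)%O. Proof. by []. Qed.

Lemma trop_le0 x : (x <= 0)%O = (x == 0).
Proof. by case: x. Qed.

Lemma trop_gt0 x : ((0 : trop R) < x)%O = (x != 0).
Proof. by rewrite ltNge trop_le0. Qed.

Lemma trop_leM x y z t : (x <= y)%O -> (z <= t)%O -> (x * z <= y * t)%O.
Proof.
move=> xy zt; apply: (@le_trans _ _ (y * z)); first exact: trop_mul_mono.
by rewrite ![y * _]mulrC; apply: trop_mul_mono.
Qed.

Lemma trop_ltM2l x y z : x != 0 -> (x * y < x * z)%O = (y < z)%O.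
Proof.
rewrite !ltNge; case: x y z => [a|] [b|] [c|] // _.
by rewrite ![(_ <= _)%O]lerD2l.
Qed.

Lemma trop_mul_eq0 x y : (x * y == 0) = (x == 0) || (y == 0).
Proof. by case: x y => [a|] [b|]. Qed.

Lemma trop_lt_leM x y z t :
  (x < y)%O -> (z <= t)%O -> t != 0 -> (x * z < y * t)%O.
Proof.
move=> xy zt t0; apply: (@le_lt_trans _ _ (x * t)); first exact: trop_leM.
by rewrite ![_ * t]mulrC trop_ltM2l.
Qed.

Lemma trop_leX x y m : (x <= y)%O -> (x ^+ m <= y ^+ m)%O.
Proof. by move=> xy; elim: m => // m IH; rewrite !exprS trop_leM. Qed.

Lemma trop_expf_neq0 x m : x != 0 -> x ^+ m != 0.
Proof. by move=> x0; elim: m => // m IH; rewrite exprS trop_mul_eq0 negb_or x0. Qed.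

Lemma trop_ltX x y m : (x < y)%O -> (0 < m)%N -> (x ^+ m < y ^+ m)%O.
Proof.
move=> xy; case: m => // m _; rewrite !exprS; apply: trop_lt_leM => //.
  by rewrite trop_leX // ltW.
by apply: trop_expf_neq0; rewrite -trop_gt0; apply: le_lt_trans xy.
Qed.

Lemma trop_leX2 x y m : (0 < m)%N -> (x ^+ m <= y ^+ m)%O -> (x <= y)%O.
Proof. by move=> m0; apply: contra_le => xy; apply: trop_ltX. Qed.

Lemma trop_le_sum (I : finType) (F : I -> trop R) i : (F i <= \sum_j F j)%O.
Proof. by rewrite (bigD1 i) //= trop_addE le_max lexx. Qed.

Lemma trop_sum_le (I : finType) (P : pred I) (F : I -> trop R) z :
  (forall i, P i -> F i <= z)%O -> (\sum_(i | P i) F i <= z)%O.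
Proof.
move=> Fz; elim/big_rec: _ => [|i y Pi yz]; first exact: trop_ge0.
by rewrite trop_addE ge_max Fz.
Qed.

Lemma trop_sum_attained (I : finType) (F : I -> trop R) (i0 : I) :
  exists i, \sum_j F j = F i.
Proof.
suff: (exists i, \sum_j F j = F i) \/ \sum_j F j = 0.
  case=> // F0; exists i0; apply/eqP; rewrite F0 eq_sym -trop_le0 -F0.
  exact: trop_le_sum.
elim/big_rec: _ => [|i y _ IH]; first by right.
rewrite trop_addE; have [iy|yi] := leP (F i) y; last by left; exists i.
exact: IH.
Qed.

Lemma trop_prod_le (I : Type) (r : seq I) (P : pred I) (F G : I -> trop R) :
  (forall i, P i -> F i <= G i)%O ->
  (\prod_(i <- r | P i) F i <= \prod_(i <- r | P i) G i)%O.
Proof. by move=> FG; elim/big_ind2: _ => // *; apply: trop_leM. Qed.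

Lemma trop_prod_neq0 (I : eqType) (r : seq I) (F : I -> trop R) :
  {in r, forall i, F i != 0} -> \prod_(i <- r) F i != 0.
Proof.
elim: r => [|i r IH] F0; first by rewrite big_nil.
rewrite big_cons trop_mul_eq0 negb_or F0 ?mem_head //=.
by apply: IH => j jr; rewrite F0 // inE jr orbT.
Qed.

(** Finiteness of the [G i] is what makes the product strictly monotone in each
    factor. *)
Lemma trop_prod_eq (I : finType) (F G : I -> trop R) :
  (forall i, F i <= G i)%O -> (forall i, G i != 0) ->
  (\prod_i G i <= \prod_i F i)%O -> F =1 G.
Proof.
move=> FG G0 le i; apply/eqP; apply: contraT => FGi.
have FiGi : (F i < G i)%O by rewrite lt_neqAle FGi FG.
have : (\prod_i F i < \prod_i G i)%O.
  rewrite (bigD1 i) //= [ltRHS](bigD1 i) //=; apply: trop_lt_leM => //.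
    exact: trop_prod_le.
  by rewrite -big_filter trop_prod_neq0.
by rewrite ltNge le.
Qed.

Lemma trop_sum_lt (I : finType) (P : pred I) (F : I -> trop R) z :
  z != 0 -> (forall i, P i -> F i < z)%O -> (\sum_(i | P i) F i < z)%O.
Proof.
move=> z0 Fz; elim/big_rec: _ => [|i y Pi yz]; first by rewrite trop_gt0.
by rewrite trop_addE gt_max Fz.
Qed.

(** Max-plus squaring doubles numbers, so it commutes with maxima. *)
Lemma trop_sum_sqr (J : finType) (F : J -> trop R) : (\sum_i F i) ^+ 2 = \sum_i F i ^+ 2.
Proof.
apply: (big_morph (fun x : trop R => x ^+ 2)) => // x y; rewrite !trop_addE.
have [xy|/ltW yx] := leP x y; first by rewrite max_r // trop_leX.
by rewrite max_l // trop_leX.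
Qed.

Section Matrices.
Variable n : nat.
Implicit Types A B : 'M[trop R]_n.

Lemma le_mulmx m p (A : 'M[trop R]_(m, n)) (B : 'M[trop R]_(n, p)) i j k :
  (A i k * B k j <= (A *m B) i j)%O.
Proof. by rewrite mxE (trop_le_sum (fun k => A i k * B k j)). Qed.

Lemma le_mul_entry A B i j k : (A i k * B k j <= (A * B) i j)%O.
Proof. exact: le_mulmx. Qed.

Lemma mul_entry_attained A B i j : exists k, (A * B) i j = A i k * B k j.
Proof. by rewrite mxE; apply: trop_sum_attained. Qed.

Lemma le_expr_entry A a b i j k :
  ((A ^+ a) i k * (A ^+ b) k j <= (A ^+ (a + b)) i j)%O.
Proof. by rewrite exprD le_mul_entry. Qed.

Lemma le_diag_expr A k m : (A k k ^+ m <= (A ^+ m) k k)%O.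
Proof.
elim: m => [|m IH]; first by rewrite !expr0 mxE eqxx.
by rewrite !exprS; apply: le_trans (le_mul_entry _ _ _ _ k); apply: trop_leM.
Qed.

End Matrices.
End Trop.

(** * Walks, and runs of a closed walk in long walks *)

Section Walks.
Variables (R : realDomainType) (n : nat).
Implicit Types (F : nat -> 'M[trop R]_n) (v : nat -> 'I_n) (M Z : 'M[trop R]_n).

Definition walk_weight F v a b : trop R := \prod_(a <= t < b) F t (v t) (v t.+1).

Lemma walk_weight_cat F v a b c : (a <= b)%N -> (b <= c)%N ->
  walk_weight F v a c = walk_weight F v a b * walk_weight F v b c.
Proof. by move=> ab bc; rewrite /walk_weight (big_cat_nat ab bc). Qed.

Lemma eq_walk_weight F v v' a b :
  (forall t, a <= t <= b -> v t = v' t)%N -> walk_weight F v a b = walk_weight F v' a b.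
Proof.
move=> vv'; rewrite /walk_weight !big_nat; apply: eq_bigr => t /andP[at_ tb].
by rewrite !vv' ?at_ ?(ltnW tb) ?tb // leqW.
Qed.

Lemma walk_weight_le F v a b : (a <= b)%N ->
  (walk_weight F v a b <= (\prod_(a <= t < b) F t) (v a) (v b))%O.
Proof.
elim: b => [|b IH]; first by rewrite leqn0 => /eqP->; rewrite /walk_weight !big_geq // mxE eqxx.
rewrite leq_eqVlt => /predU1P[->|ab].
  by rewrite /walk_weight !big_geq // mxE eqxx.
rewrite /walk_weight !(big_nat_recr b) //=.
by apply: le_trans (le_mul_entry _ _ _ _ (v b)); apply: trop_leM => //; apply: IH.
Qed.

(** Products of max-plus matrices are maxima over vertex sequences, and these are
    attained. Finiteness of the entry excludes the empty product between two
    different vertices, which no vertex sequence joins. *)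
Lemma walk_attained F a b i j : (a <= b)%N -> (\prod_(a <= t < b) F t) i j != 0 ->
  exists v, [/\ v a = i, v b = j & (\prod_(a <= t < b) F t) i j = walk_weight F v a b].
Proof.
elim: b j => [|b IH] j.
  rewrite leqn0 => /eqP->; rewrite /walk_weight !big_geq // mxE.
  by have [->|//] := eqVneq i j; exists (fun=> j); rewrite !big_geq.
rewrite leq_eqVlt => /predU1P[->|ab].
  rewrite /walk_weight !big_geq // mxE.
  by have [->|//] := eqVneq i j; exists (fun=> j); rewrite !big_geq.
rewrite big_nat_recr //=; have [k ->] := mul_entry_attained (\prod_(a <= t < b) F t) (F b) i j.
rewrite trop_mul_eq0 negb_or => /andP[/(IH _ ab)[v [va vb ->]] _].
exists (fun t => if (t <= b)%N then v t else j).
have ab' : (a <= b)%N by [].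
rewrite ab' ltnn; split=> //.
rewrite (walk_weight_cat _ _ ab' (leqnSn b)); congr (_ * _).
  by apply: eq_walk_weight => t /andP[_ ->].
by rewrite /walk_weight big_nat1 leqnn ltnn vb.
Qed.

Lemma expr_prod_const M a b : \prod_(a <= t < b) M = M ^+ (b - a).
Proof. by rewrite big_const_nat iter_mulr_1. Qed.

Lemma walk_weight_le_expr M v a b : (a <= b)%N ->
  (walk_weight (fun=> M) v a b <= (M ^+ (b - a)) (v a) (v b))%O.
Proof. by move/(walk_weight_le (fun=> M) v); rewrite expr_prod_const. Qed.

Lemma expr_walk_attained M s i j : (M ^+ s) i j != 0 ->
  exists v, [/\ v 0%N = i, v s = j & (M ^+ s) i j = walk_weight (fun=> M) v 0 s].
Proof.
by have := @walk_attained (fun=> M) 0 s i j (leq0n s); rewrite expr_prod_const subn0.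
Qed.

Lemma repeated_vertex s (v : nat -> 'I_n) : (n <= s)%N ->
  exists a b, [/\ (a < b)%N, (b <= s)%N & v a = v b].
Proof.
move=> ns.
have /injectivePn[x [y xy vxy]] : ~~ injectiveb (fun t : 'I_s.+1 => v t).
  apply/negP => /injectiveP/leq_card; rewrite !card_ord; lia.
have [lt_xy|lt_yx|/val_inj/eqP] := ltngtP x y; last by rewrite (negPf xy).
- by exists x, y; split=> //; rewrite -ltnS.
- by exists y, x; split=> //; rewrite -ltnS.
Qed.

Lemma closed_subwalk M i j : (M ^+ n) i j != 0 ->
  exists x a l b, [/\ (0 < l)%N, (a + l + b = n)%N &
    ((M ^+ n) i j <= (M ^+ a) i x * (M ^+ l) x x * (M ^+ b) x j)%O].
Proof.
move/expr_walk_attained => [v [v0 vn ->]].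
have [a [b [ab bn vab]]] := repeated_vertex v (leqnn n).
exists (v a), a, (b - a)%N, (n - b)%N; split; [lia|lia|].
rewrite (walk_weight_cat _ _ (leq0n b) bn) (walk_weight_cat _ _ (leq0n a) (ltnW ab)).
have w1 := walk_weight_le_expr M v (leq0n a).
have w2 := walk_weight_le_expr M v (ltnW ab).
have w3 := walk_weight_le_expr M v bn.
rewrite v0 subn0 in w1; rewrite -vab in w2; rewrite -vab vn in w3.
exact: trop_leM (trop_leM w1 w2) w3.
Qed.

(** Some optimal walk of length [s] from [i] to [j] runs [t] times in a row
    through one closed walk of length [l]. *)
Definition has_run M l t s i j : Prop :=
  exists x a b, (a + t * l + b = s)%N /\
    ((M ^+ s) i j <= (M ^+ a) i x * (M ^+ l) x x ^+ t * (M ^+ b) x j)%O.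

Lemma has_run_sub M l t t' s i j :
  (t' <= t)%N -> has_run M l t s i j -> has_run M l t' s i j.
Proof.
move=> t't [x [a [b [e le]]]]; exists x, a, ((t - t') * l + b)%N; split; first nia.
apply: (le_trans le); rewrite -{1}(subnKC t't) exprD -!mulrA.
rewrite !trop_leM //; apply: le_trans (le_expr_entry _ _ _ _ _ x).
by rewrite mulnC exprM trop_leM // le_diag_expr.
Qed.

(** Closed walks of the same length can be moved from one place of a walk to
    another without changing its length, so two runs are concentrated at the
    heavier one of the two closed walks. *)
Lemma has_run_merge M l t1 t2 s1 s2 i j k :
  ((M ^+ (s1 + s2)) i j <= (M ^+ s1) i k * (M ^+ s2) k j)%O ->
  has_run M l t1 s1 i k -> has_run M l t2 s2 k j -> has_run M l (t1 + t2) (s1 + s2) i j.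
Proof.
move=> le [x [a [b [e1 le1]]]] [y [c [d [e2 le2]]]].
set al := (M ^+ l) x x in le1 *; set be := (M ^+ l) y y in le2 *.
have {}le := le_trans le (trop_leM le1 le2).
have [ab|/ltW ba] := leP al be.
- exists y, (a + b + c)%N, d; split; first nia.
  apply: le_trans le _; rewrite -/be (exprD be).
  rewrite (_ : _ * _ = (M ^+ a) i x * (M ^+ b) x k * (M ^+ c) k y *
    (al ^+ t1 * be ^+ t2) * (M ^+ d) y j); last by ring.
  apply: trop_leM => //; apply: trop_leM; last by rewrite trop_leM ?trop_leX.
  apply: le_trans (le_expr_entry _ _ _ _ _ k).
  by rewrite trop_leM ?le_expr_entry.
- exists x, a, (b + c + d)%N; split; first nia.
  apply: le_trans le _; rewrite -/al (exprD al).
  rewrite (_ : _ * _ = (M ^+ a) i x * (al ^+ t1 * be ^+ t2) *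
    ((M ^+ b) x k * (M ^+ c) k y * (M ^+ d) y j)); last by ring.
  apply: trop_leM; first by rewrite !trop_leM ?trop_leX.
  apply: le_trans (le_expr_entry _ _ _ _ _ y).
  by rewrite trop_leM ?le_expr_entry.
Qed.

Lemma has_run_cat M l t s s' i j k :
  ((M ^+ (s + s')) i j <= (M ^+ s) i k * (M ^+ s') k j)%O ->
  has_run M l t s i k -> has_run M l t (s + s') i j.
Proof.
move=> le r; rewrite -(addn0 t); apply: has_run_merge le r _.
by exists k, 0%N, s'; split; rewrite ?expr0 ?mxE ?eqxx ?mulr1 ?mul1r.
Qed.

(** Each block of [n] steps contains a closed walk of some length at most [n];
    [c l] counts the blocks that contribute one of length [l + 1]. *)
Lemma long_walk_runs M G i j : (M ^+ (G * n)) i j != 0 ->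
  exists c : 'I_n -> nat, (\sum_l c l = G)%N /\
    forall l : 'I_n, has_run M l.+1 (c l) (G * n) i j.
Proof.
elim: G j => [|G IH] j.
  rewrite mul0n expr0 mxE; have [->|//] := eqVneq i j; move=> _.
  exists (fun=> 0%N); split=> [|l]; first by rewrite big1.
  by exists j, 0%N, 0%N; rewrite !expr0 mxE eqxx !mulr1.
rewrite mulSnr => ij0.
have [k e] := mul_entry_attained (M ^+ (G * n)) (M ^+ n) i j.
have le : ((M ^+ (G * n + n)) i j <= (M ^+ (G * n)) i k * (M ^+ n) k j)%O.
  by rewrite exprD e.
move: ij0; rewrite exprD e trop_mul_eq0 negb_or => /andP[/IH[c [cG run]]].
case/closed_subwalk => [x [a [l [b [l0 abn lex]]]]].
have ln : (l.-1 < n)%N by lia.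
exists (fun m => c m + (m == Ordinal ln))%N; split.
  rewrite big_split /= cG (bigD1 (Ordinal ln)) //= eqxx big1 ?addn0 ?addn1 //.
  by move=> m /negPf->.
move=> m; have [->|_] := eqVneq m; last by rewrite addn0; apply: has_run_cat le _.
apply: has_run_merge le (run _) _; rewrite /= prednK //.
by exists x, a, b; rewrite mul1n expr1.
Qed.

(** Among more than [n * (N * K)] blocks, some length [l] occurs at least
    [N * K] times. As [l] divides [N], repetitions of the closed walk of length
    [l] make up one of length [N]. *)
Lemma long_walk_has_run M N K i j : (forall l : 'I_n, l.+1 %| N)%N -> (0 < N)%N ->
  (M ^+ ((n * (N * K)).+1 * n)) i j != 0 -> has_run M N K ((n * (N * K)).+1 * n) i j.
Proof.
move=> dvdN N0 /long_walk_runs[c [sumc run]].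
have [l cl] : exists l, (N * K <= c l)%N.
  apply/existsP; apply: contraT => /existsPn small.
  have : (\sum_l c l <= \sum_(l < n) N * K)%N.
    by apply: leq_sum => l _; apply: ltnW; rewrite ltnNge.
  by rewrite sumc sum_nat_const card_ord ltnn.
have /dvdnP[e Ne] := dvdN l.
have eK : (e * K <= c l)%N by apply: leq_trans cl; rewrite Ne; nia.
have [x [a [b [eq le]]]] := has_run_sub eK (run l).
exists x, a, b; split; first by rewrite -eq Ne; nia.
apply: le_trans le _; rewrite trop_leM // trop_leM // exprM trop_leX //.
by rewrite Ne mulnC exprM le_diag_expr.
Qed.
End Walks.

(** * A power of a matrix factors or is rigid *)

Section Dichotomy.
Variables (R : realDomainType) (n : nat).
Implicit Types (M Z : 'M[trop R]_n).

(** The loop at [k] is absent, or does not strictly beat a closed walk of length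
    at most [K] that visits another vertex. *)
Definition loose_at Z K k : Prop :=
  Z k k = 0 \/ exists q r y, [/\ y != k, (q + r <= K)%N &
    (Z k k ^+ (q + r) <= (Z ^+ q) k y * (Z ^+ r) y k)%O].

Definition rigid Z K : Prop := forall k, Z k k != 0 /\
  forall q r y, y != k -> (q + r <= K)%N ->
    ((Z ^+ q) k y * (Z ^+ r) y k < Z k k ^+ (q + r))%O.

Lemma trmx_expr M s : (M^T) ^+ s = (M ^+ s)^T.
Proof.
elim: s => [|s IH]; first by rewrite !expr0 trmx1.
by rewrite exprS IH exprSr; apply: esym (trmx_mul _ _).
Qed.

Lemma loose_at_tr Z K k : loose_at Z K k -> loose_at Z^T K k.
Proof.
case=> [Zk|[q [r [y [yk qr le]]]]]; [by left; rewrite mxE|right].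
exists r, q, y; split=> //; first by rewrite addnC.
by rewrite !trmx_expr !mxE addnC mulrC.
Qed.

(** An optimal walk of [K] steps that starts in [k] either leaves [k] by itself, or
    stays there throughout and then can take the closed walk that makes [k] loose
    instead of as many loops. *)
Lemma loose_detour Z K k c : (0 < K)%N -> loose_at Z K k -> (Z ^+ K) k c != 0 ->
  exists q y, [/\ (q <= K)%N, y != k &
    ((Z ^+ K) k c <= (Z ^+ q) k y * (Z ^+ (K - q)) y c)%O].
Proof.
move=> K0 loose Zkc0; have [v [v0 vK e]] := expr_walk_attained Zkc0.
have [/existsP[q vq]|/existsPn stay] := boolP [exists q : 'I_K.+1, v q != k].
  exists q, (v q); split=> //; first by rewrite -ltnS.
  have qK : (q <= K)%N by rewrite -ltnS.
  rewrite e (walk_weight_cat _ _ (leq0n q) qK).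
  have := walk_weight_le_expr Z v (leq0n q); rewrite v0 subn0 => w1.
  have := walk_weight_le_expr Z v qK; rewrite vK => w2.
  exact: trop_leM w1 w2.
have vk t : (t <= K)%N -> v t = k.
  by rewrite -ltnS => tK; apply/eqP; have := stay (Ordinal tK); rewrite negbK.
have eK : (Z ^+ K) k c = Z k k ^+ K.
  rewrite e /walk_weight big_nat (eq_bigr (fun=> Z k k)); last first.
    by move=> t tK; rewrite !vk // ltnW.
  by rewrite -big_nat big_const_nat iter_mulr_1 subn0.
have ck : c = k by rewrite -vK vk.
case: loose => [Zk0|[q [r [y [yk qrK le]]]]].
  by move: Zkc0; rewrite eK Zk0 expr0n eqn0Ngt K0 eqxx.
exists q, y; split; [lia|done|rewrite eK ck].
have -> : K = (q + r + (K - q - r))%N by lia.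
rewrite exprD; apply: le_trans (trop_leM le (le_diag_expr _ _ _)) _.
rewrite -mulrA; apply: trop_leM => //.
apply: le_trans (le_expr_entry _ _ _ _ _ _) _.
by rewrite (_ : r + _ = q + r + (K - q - r) - q)%N //; lia.
Qed.

Lemma le_expr_cat M x y a b s i k j : (a + b = s)%N ->
  (x <= (M ^+ a) i k)%O -> (y <= (M ^+ b) k j)%O -> (x * y <= (M ^+ s) i j)%O.
Proof. by move=> <- xa yb; apply: le_trans (le_expr_entry _ _ _ _ _ k); apply: trop_leM. Qed.

Lemma le_expr_loop M N x q : ((M ^+ N) x x ^+ q <= (M ^+ (N * q)) x x)%O.
Proof. by rewrite exprM le_diag_expr. Qed.

(** The cut is at time [T + N * K], in the middle of the walk, where it is at [k].
    Moving [q] copies of the closed walk at [x] to the one at [x'] brings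
    to the cut the vertex that was reached [q * N] steps later, and
    [loose_detour] chooses [q] and a rest of the walk such that this vertex is not
    [k]. *)
Lemma shift_cut M N K T k c c' i j x x' a b a' b' :
  (0 < K)%N -> loose_at (M ^+ N) K k ->
  (a + K * N + b = T)%N -> (a' + K * N + b' = T)%N ->
  ((M ^+ N) x x <= (M ^+ N) x' x')%O -> (M ^+ (N * K)) k c' != 0 ->
  exists2 y, y != k &
  (((M ^+ a) i x * (M ^+ N) x x ^+ K * (M ^+ b) x c * (M ^+ (N * K)) c k) *
   ((M ^+ (N * K)) k c' *
     ((M ^+ a') c' x' * (M ^+ N) x' x' ^+ K * (M ^+ b') x' j))
   <= (M ^+ (T + N * K)) i y * (M ^+ (T + N * K)) y j)%O.
Proof.
move=> K0 loose eT eT' le; rewrite exprM => kc0.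
have [q [y [qK yk dle]]] := loose_detour K0 loose kc0.
exists y => //.
set al := (M ^+ N) x x in le *; set be := (M ^+ N) x' x' in le *.
apply: (@le_trans _ _
  (((M ^+ a) i x * al ^+ (K - q) * (M ^+ b) x c * (M ^+ (N * K)) c k * (M ^+ N ^+ q) k y) *
   ((M ^+ N ^+ (K - q)) y c' * ((M ^+ a') c' x' * be ^+ (K + q) * (M ^+ b') x' j)))).
  (* the one place where the weights of the two closed walks are compared *)
  have step : (al ^+ K * be ^+ K <= al ^+ (K - q) * be ^+ (K + q))%O.
    rewrite -{1}(subnK qK) !exprD -!mulrA trop_leM // mulrC trop_leM //.
    exact: trop_leX.
  rewrite (_ : _ * _ = (M ^+ a) i x * (M ^+ b) x c * (M ^+ (N * K)) c k *
    (M ^+ a') c' x' * (M ^+ b') x' j * (al ^+ K * be ^+ K) * (M ^+ N ^+ K) k c');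
    last by rewrite -!exprM; ring.
  rewrite [X in (_ <= X)%O](_ : _ = (M ^+ a) i x * (M ^+ b) x c * (M ^+ (N * K)) c k *
    (M ^+ a') c' x' * (M ^+ b') x' j * (al ^+ (K - q) * be ^+ (K + q)) *
    ((M ^+ N ^+ q) k y * (M ^+ N ^+ (K - q)) y c')); last by rewrite -!exprM; ring.
  by rewrite trop_leM // trop_leM.
apply: trop_leM.
  apply: (@le_expr_cat _ _ _ (a + N * (K - q) + b + N * K) (N * q) _ _ k); first nia.
    apply: (@le_expr_cat _ _ _ _ _ _ _ c _ erefl) => //.
    apply: (@le_expr_cat _ _ _ _ _ _ _ x _ erefl) => //.
    by apply: (@le_expr_cat _ _ _ _ _ _ _ x _ erefl) => //; apply: le_expr_loop.
  by rewrite exprM.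
apply: (@le_expr_cat _ _ _ (N * (K - q)) (a' + N * (K + q) + b') _ _ c'); first nia.
  by rewrite exprM.
apply: (@le_expr_cat _ _ _ _ _ _ _ x' _ erefl) => //.
by apply: (@le_expr_cat _ _ _ _ _ _ _ x' _ erefl) => //; apply: le_expr_loop.
Qed.

(** Both halves of a walk of length [h + h] contain a run of [K] closed walks of
    length [N] that lies at least [N * K] steps away from the cut. The lighter one
    gives copies to the heavier one; by transposition the first half may be
    assumed to be the lighter. *)
Lemma cut_avoids_loose M N K k i j :
  let h := ((n * (N * K)).+1 * n + N * K)%N in
  (forall l : 'I_n, l.+1 %| N)%N -> (0 < N)%N -> (0 < K)%N ->
  loose_at (M ^+ N) K k -> (M ^+ (h + h)) i j != 0 ->
  exists2 y, y != k & ((M ^+ (h + h)) i j <= (M ^+ h) i y * (M ^+ h) y j)%O.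
Proof.
set T := (_ * n)%N => h dvdN N0 K0 loose; rewrite exprD => ij0.
have [y e] := mul_entry_attained (M ^+ h) (M ^+ h) i j.
have [yk|yk] := eqVneq y k; last by exists y; rewrite ?e.
have [c eik] : exists c, (M ^+ h) i k = (M ^+ T) i c * (M ^+ (N * K)) c k.
  by rewrite /h exprD; apply: mul_entry_attained.
have [c' ekj] : exists c, (M ^+ h) k j = (M ^+ (N * K)) k c * (M ^+ T) c j.
  by rewrite /h addnC exprD; apply: mul_entry_attained.
move: ij0; rewrite e yk eik ekj !trop_mul_eq0 !negb_or.
move=> /andP[/andP[ic ck] /andP[kc' c'j]].
have [x [a [b [eT le]]]] := long_walk_has_run dvdN N0 ic.
have [x' [a' [b' [eT' le']]]] := long_walk_has_run dvdN N0 c'j.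
have bound := trop_leM (trop_leM le (lexx ((M ^+ (N * K)) c k)))
   (trop_leM (lexx ((M ^+ (N * K)) k c')) le').
have [al_be|/ltW be_al] := leP ((M ^+ N) x x) ((M ^+ N) x' x').
  have [z zk le2] := shift_cut c i j K0 loose eT eT' al_be kc'.
  by exists z => //; apply: le_trans bound _.
have loose' : loose_at ((M^T) ^+ N) K k by rewrite trmx_expr; apply: loose_at_tr.
have eb' : (b' + K * N + a' = T)%N by lia.
have eb : (b + K * N + a = T)%N by lia.
have [||z zk] := @shift_cut M^T N K T k c' c j i x' x b' a' b a K0 loose' eb' eb.
- by rewrite !trmx_expr !mxE.
- by rewrite !trmx_expr !mxE.
- rewrite !trmx_expr !mxE => le2; exists z => //.
  apply: le_trans bound _; rewrite [leRHS]mulrC.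
  by apply: le_trans le2; rewrite le_eqVlt; apply/orP; left; apply/eqP; ring.
Qed.

End Dichotomy.

(** If [k] is loose, every entry of the power is attained by a walk that is not at
    [k] at half time, so the column and the row of [k] can be deleted from the two
    factors. *)
Lemma power_factors_or_rigid (R : realDomainType) n (M : 'M[trop R]_n.+1) N K :
  let h := ((n.+1 * (N * K)).+1 * n.+1 + N * K)%N in
  (forall l : 'I_n.+1, l.+1 %| N)%N -> (0 < N)%N -> (0 < K)%N ->
  (exists (X : 'M_(n.+1, n)) (Y : 'M_(n, n.+1)), M ^+ (h + h) = X *m Y) \/
  rigid (M ^+ N) K.
Proof.
move=> h dvdN N0 K0.
have [[k loose]|tight] := boolp.EM (exists k, loose_at (M ^+ N) K k); [left|right].
  exists (col' k (M ^+ h)), (row' k (M ^+ h)).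
  apply/matrixP => i j; apply: le_anti; apply/andP; split; last first.
    rewrite mxE; apply: trop_sum_le => l _; rewrite !mxE; exact: le_expr_entry.
  have [->//|ij0] := eqVneq ((M ^+ (h + h)) i j) 0.
  have [y yk le] := cut_avoids_loose dvdN N0 K0 loose ij0.
  apply: le_trans le _; rewrite eq_sym in yk; have [l -> _] := unlift_some yk.
  by apply: le_trans (le_mulmx _ _ _ _ l); rewrite !mxE.
move=> k; split; first by apply/eqP => Zk0; apply: tight; exists k; left.
move=> q r y yk qrK; rewrite ltNge; apply/negP => le.
by apply: tight; exists k; right; exists q, r, y.
Qed.

(** * Diagonals of words in rigid matrices *)

Section Rigid.
Variables (R : realDomainType) (n : nat).
Implicit Types (M Z : 'M[trop R]_n).

Definition perm_dominated M : Prop :=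
  forall s : {perm 'I_n}, (\prod_k M k (s k) <= \prod_k M k k)%O.

(** The orbit of a vertex [k] under [s] is a closed walk, so by rigidity its weight,
    repeated up to the order [m] of [s], is at most that of [m] loops at [k].
    Multiplying over all [k] gives the [m]-th power of the claim. *)
Lemma rigid_perm_dominated Z K : (n`! <= K)%N -> rigid Z K -> perm_dominated Z.
Proof.
move=> nK rig s; set m := #[s]%g.
have m0 : (0 < m)%N by apply: order_gt0.
have mK : (m <= K)%N.
  by apply: leq_trans nK; rewrite -card_Sn; apply: max_card.
apply: (trop_leX2 m0).
have -> : (\prod_k Z k (s k)) ^+ m =
    \prod_k \prod_(0 <= t < m) Z ((s ^+ t)%g k) ((s ^+ t.+1)%g k).
  rewrite exchange_big /= -(subn0 m) -iter_mulr_1 -big_const_nat subn0.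
  apply: eq_bigr => t _; rewrite (reindex_inj (@perm_inj _ (s ^+ t)%g)).
  by apply: eq_bigr => k _; rewrite expgSr permM.
rewrite -prodrXl; apply: trop_prod_le => k _.
have [Zk0 str] := rig k.
have [sk|sk] := eqVneq (s k) k.
  have fixk t : (s ^+ t)%g k = k by elim: t => [|t IH]; rewrite ?perm1 // expgSr permM IH.
  by rewrite (eq_bigr (fun=> Z k k)) ?big_const_nat ?iter_mulr_1 ?subn0 // => t _; rewrite !fixk.
apply: ltW; have := str 1%N m.-1 (s k) sk; rewrite add1n prednK // => /(_ mK).
apply: le_lt_trans.
have := walk_weight_cat (fun=> Z) (fun t => (s ^+ t)%g k) (leq0n 1) m0.
rewrite {1}/walk_weight => ->; apply: trop_leM.
  by rewrite /walk_weight big_nat1 !expr1 perm1 expg1.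
have := walk_weight_le_expr Z (fun t => (s ^+ t)%g k) m0.
by rewrite expg1 expg_order perm1 subn1.
Qed.

(** Take an optimal closed walk at every vertex. If two of them were at the same
    vertex at the same time, exchanging their ends would contradict [swap].
    Hence at each time they occupy all vertices, each step moves them by a
    permutation, and permutations are no heavier than the loops. *)
Lemma prod_diag_additive (F : nat -> 'M[trop R]_n) s :
  let Y := \prod_(0 <= t < s) F t in
  (forall t, (t < s)%N -> perm_dominated (F t)) ->
  (forall t k, (t < s)%N -> F t k k != 0) ->
  (forall k l, k != l -> (Y k l * Y l k < Y k k * Y l l)%O) ->
  forall k, Y k k = \prod_(0 <= t < s) F t k k.
Proof.
move=> Y dom diag0 swap.
have DY k : (\prod_(0 <= t < s) F t k k <= Y k k)%O.
  exact: (walk_weight_le F (fun=> k) (leq0n s)).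
have Y0 k : Y k k != 0.
  rewrite -trop_gt0; apply: lt_le_trans (DY k); rewrite trop_gt0.
  by apply: trop_prod_neq0 => t; rewrite mem_index_iota => /andP[_]; apply: diag0.
have [v vP] := fin_all_exists (fun k => walk_attained (leq0n s) (Y0 k)).
have vinj t : (t <= s)%N -> injective (v ^~ t).
  move=> ts k l vkl; apply/eqP; apply: contraT => kl.
  have [vk0 vks ek] := vP k; have [vl0 vls el] := vP l.
  have := swap k l kl; rewrite ltNge => /negP[]; rewrite {1}/Y ek {1}/Y el.
  rewrite !(walk_weight_cat _ _ (leq0n t) ts) mulrACA.
  rewrite (mulrC (walk_weight F (v k) t s)) mulrACA.
  have le k1 l1 : v k1 0%N = k1 -> v l1 s = l1 -> v k1 t = v l1 t ->
      (walk_weight F (v k1) 0 t * walk_weight F (v l1) t s <= Y k1 l1)%O.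
    move=> e0 es et; rewrite /Y (big_cat_nat (leq0n t) ts) /=.
    apply: le_trans (le_mul_entry _ _ _ _ (v k1 t)).
    have := walk_weight_le F (v k1) (leq0n t); rewrite e0 => w1.
    have := walk_weight_le F (v l1) ts; rewrite es -et => w2.
    exact: trop_leM.
  by apply: trop_leM; apply: le.
suff le : (\prod_k Y k k <= \prod_k \prod_(0 <= t < s) F t k k)%O.
  by move=> k; apply/esym; apply: (trop_prod_eq DY Y0 le).
rewrite (eq_bigr (fun k => walk_weight F (v k) 0 s)); last by move=> k _; case: (vP k).
rewrite exchange_big [leRHS]exchange_big /= !big_nat.
apply: trop_prod_le => t /andP[_ ts].
(* the positions of all walks before and after step [t] *)
pose s1 := perm (vinj t (ltnW ts)); pose s2 := perm (vinj t.+1 ts).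
apply: le_trans (dom t ts (s1^-1 * s2)%g).
rewrite [leRHS](reindex_inj (@perm_inj _ s1)) /=.
by rewrite le_eqVlt; apply/orP; left; apply/eqP/eq_bigr => k _; rewrite permM permK !permE.
Qed.

(** Rigidity of a power of the word suffices: [swap] for that power follows from
    closed walks with two steps, and its diagonal bounds the powers of the diagonal
    of the word. *)
Lemma word_diag_additive (T : Type) (f : T -> 'M[trop R]_n) (w : seq T) N :
  (0 < N)%N -> (forall x, perm_dominated (f x)) -> (forall x k, f x k k != 0) ->
  rigid ((\prod_(x <- w) f x) ^+ N) 2 ->
  forall k, ((\prod_(x <- w) f x) k k <= \prod_(x <- w) f x k k)%O.
Proof.
move=> N0 dom diag0 rig k; apply: (trop_leX2 N0).
case: w rig => [|x0 w] rig; first by rewrite !big_nil mxE eqxx.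
set W := x0 :: w in rig *; set Y := _ ^+ N in rig.
pose ws := flatten (nseq N W).
have Ye : Y = \prod_(0 <= t < size ws) f (nth x0 ws t).
  by rewrite -(big_nth x0 xpredT f) big_flatten big_nseq /Y /= iter_mulr_1.
have swap a b : a != b -> (Y a b * Y b a < Y a a * Y b b)%O.
  move=> ab; have ba : b != a by rewrite eq_sym.
  have [_ /(_ 1%N 1%N b ba isT)] := rig a.
  have [_ /(_ 1%N 1%N a ab isT)] := rig b.
  rewrite !expr1 !addn1 !expr2 (mulrC (Y b a)) => ltb lta.
  have [le|/ltW le] := leP (Y a a) (Y b b).
    by apply: lt_le_trans lta _; apply: trop_leM.
  by apply: lt_le_trans ltb _; apply: trop_leM.
have := @prod_diag_additive (fun t => f (nth x0 ws t)) (size ws).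
rewrite /= -Ye => /(_ (fun _ _ => dom _) (fun _ _ _ => diag0 _ _) swap k).
rewrite -(big_nth x0 xpredT (fun x => f x k k)) big_flatten big_nseq /= iter_mulr_1 => <-.
exact: le_diag_expr.
Qed.

End Rigid.

(** * Counting the jumps of a walk *)

Section Jumps.
Variables (R : realDomainType) (n : nat).
Local Notation mx := 'M[trop R]_n.+1.
Implicit Types (M : mx) (A B C S : {poly mx}).

Definition loops M : mx := \matrix_(i, j) (if i == j then M i j else 0).
Definition jumps M : mx := \matrix_(i, j) (if i == j then 0 else M i j).

(** The variable marks the steps between different vertices, the jumps: in a
    product of these polynomials, the coefficient of degree [k] collects the walks
    with exactly [k] jumps. *)
Definition jump_poly M : {poly mx} := (loops M)%:P + (jumps M)%:P * 'X.

Definition coef0_diag A : Prop := forall i j, i != j -> A`_0 i j = 0.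

Lemma coefM_entry_le A B a b i j k :
  (A`_a i k * B`_b k j <= (A * B)`_(a + b) i j)%O.
Proof.
rewrite coefM summxE.
have ab : (a < (a + b).+1)%N by lia.
apply: le_trans (trop_le_sum _ (Ordinal ab)) => /=.
by rewrite addKn; apply: le_mul_entry.
Qed.

Lemma coefM_le A B x y a b i j k s : (a + b = s)%N ->
  (x <= A`_a i k)%O -> (y <= B`_b k j)%O -> (x * y <= (A * B)`_s i j)%O.
Proof.
by move=> <- xa yb; apply: le_trans (coefM_entry_le _ _ _ _ _ _ k); apply: trop_leM.
Qed.

Lemma coefM_attained A B s i j : exists a b k, (a + b = s)%N /\
  (A * B)`_s i j = A`_a i k * B`_b k j.
Proof.
rewrite coefM summxE.
have [a ->] := trop_sum_attained (fun a : 'I_s.+1 => (A`_a * B`_(s - a)) i j) ord0.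
have [k ->] := mul_entry_attained A`_a B`_(s - a) i j.
by exists a, (s - a)%N, k; split=> //; rewrite subnKC // -ltnS.
Qed.

Lemma coef0_diagM A B : coef0_diag A -> coef0_diag B -> coef0_diag (A * B).
Proof.
move=> dA dB i j ij; rewrite coef0M.
have [k ->] := mul_entry_attained A`_0 B`_0 i j.
have [ik|ik] := eqVneq i k; last by rewrite dA ?mul0r.
by rewrite dB ?mulr0 // -ik.
Qed.

Lemma diagM_entry A B i : coef0_diag A -> coef0_diag B ->
  (A * B)`_0 i i = A`_0 i i * B`_0 i i.
Proof.
move=> dA dB; apply: le_anti; rewrite (coefM_entry_le A B 0 0) andbT coef0M.
have [k ->] := mul_entry_attained A`_0 B`_0 i i.
have [<-//|ik] := eqVneq i k; by rewrite (dA i k ik) mul0r trop_ge0.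
Qed.

(** If the middle factor contributes fewer than [s] jumps, then it can be replaced
    by [C]. Otherwise the outer factors only contribute loops, which leaves a single
    walk weight to be compared. *)
Lemma swap_middle S A C (d : 'I_n.+1 -> trop R) s i j :
  coef0_diag S ->
  (forall i, S`_0 i i = d i ^+ 2) ->
  (forall k, (k < s)%N -> A`_k = C`_k) ->
  (d i ^+ 2 * A`_s i j * d j ^+ 2 <= (S * C * S)`_s i j)%O ->
  ((S * A * S)`_s i j <= (S * C * S)`_s i j)%O.
Proof.
move=> dS Sd AC le.
have [ab [c [y [abc ->]]]] := coefM_attained (S * A) S s i j.
have [a [b [x [eab ->]]]] := coefM_attained S A ab i y.
have [bs|sb] := ltnP b s.
  by apply: (coefM_le abc) => //; apply: (coefM_le eab) => //; rewrite AC.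
have [a0 [c0 bs]] : a = 0%N /\ c = 0%N /\ b = s by lia.
move: le; rewrite a0 c0 bs.
have [<-|ix] := eqVneq i x; last by rewrite dS ?mul0r.
have [->|yj] := eqVneq y j; last by rewrite [S`_0 y j]dS ?mulr0.
by rewrite !Sd.
Qed.

(** Suppose that [A] and [B] agree up to [s - 1] jumps and have the same loops [d],
    and consider a walk that makes all its [s] jumps inside the middle factor [A].
    The other product has copies of [A] on both sides of its middle factor; moving
    the jumps into one of these copies changes the weight by a power of
    [d j / d i] on one side and of [d i / d j] on the other, so one of the two
    moves loses nothing. *)
Lemma swap_in_context A B (d : 'I_n.+1 -> trop R) s :
  coef0_diag A -> coef0_diag B -> (forall i, A`_0 i i = d i) -> (forall i, B`_0 i i = d i) ->
  (forall k, (k < s)%N -> A`_k = B`_k) ->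
  (A * B * A * (A * B))`_s = (A * B * B * (A * B))`_s.
Proof.
move=> dA dB Ad Bd AB; have dAB := coef0_diagM dA dB.
have dABi i : (A * B)`_0 i i = d i ^+ 2 by rewrite diagM_entry // Ad Bd expr2.
have s0 : (s + 0 = s)%N by rewrite addn0.
have leA i : (d i <= A`_0 i i)%O by rewrite Ad.
have leB i : (d i <= B`_0 i i)%O by rewrite Bd.
have leAB i : (d i ^+ 2 <= (A * B)`_0 i i)%O by rewrite dABi.
have [sqr3 sqr4] : (forall x y : trop R, (x <= y)%O -> (x ^+ 2 * y ^+ 2 <= y ^+ 4)%O) /\
   (forall x y : trop R, (x <= y)%O -> (x ^+ 2 * y ^+ 2 <= x * y ^+ 3)%O).
  split=> x y xy.
    rewrite (_ : y ^+ 4 = y ^+ 2 * y ^+ 2); last by ring.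
    by rewrite trop_leM ?trop_leX.
  rewrite (_ : x ^+ 2 * y ^+ 2 = x * (x * y ^+ 2)); last by ring.
  rewrite (_ : y ^+ 3 = y * y ^+ 2); last by ring.
  by rewrite !trop_leM.
apply/matrixP => i j; apply: le_anti; apply/andP; split.
- apply: (swap_middle dAB dABi) => //.
  have [ij|/ltW ji] := leP (d i) (d j).
  + apply: (@le_trans _ _ (A`_s i j * d j * d j * d j ^+ 2)).
      rewrite [X in (X <= _)%O](_ : _ = A`_s i j * (d i ^+ 2 * d j ^+ 2)); last by ring.
      rewrite [X in (_ <= X)%O](_ : _ = A`_s i j * d j ^+ 4); last by ring.
      by rewrite trop_leM ?sqr3.
    apply: (coefM_le s0) (leAB j).
    apply: (coefM_le s0) (leB j).
    by apply: (coefM_le s0) (leB j).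
  + apply: (@le_trans _ _ (d i ^+ 2 * d i * (A`_s i j * d j))).
      rewrite (_ : d i ^+ 2 * _ * _ = A`_s i j * (d j ^+ 2 * d i ^+ 2)); last by ring.
      rewrite [X in (_ <= X)%O](_ : _ = A`_s i j * (d j * d i ^+ 3)); last by ring.
      by rewrite trop_leM ?sqr4.
    apply: (@coefM_le _ _ _ _ 0 s _ _ i) => //.
      by apply: (@coefM_le _ _ _ _ 0 0 _ _ i).
    by apply: (coefM_le s0) (leB j).
- apply: (swap_middle dAB dABi) => [k ks|]; first by rewrite AB.
  have [ij|/ltW ji] := leP (d i) (d j).
  + apply: (@le_trans _ _ (d i * B`_s i j * d j * d j ^+ 2)).
      rewrite (_ : d i ^+ 2 * _ * _ = B`_s i j * (d i ^+ 2 * d j ^+ 2)); last by ring.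
      rewrite [X in (_ <= X)%O](_ : _ = B`_s i j * (d i * d j ^+ 3)); last by ring.
      by rewrite trop_leM ?sqr4.
    apply: (coefM_le s0) (leAB j).
    apply: (coefM_le s0) (leA j).
    by apply: (@coefM_le _ _ _ _ 0 s _ _ i).
  + apply: (@le_trans _ _ (d i ^+ 2 * d i * (d i * B`_s i j))).
      rewrite (_ : d i ^+ 2 * _ * _ = B`_s i j * (d j ^+ 2 * d i ^+ 2)); last by ring.
      rewrite [X in (_ <= X)%O](_ : _ = B`_s i j * d i ^+ 4); last by ring.
      by rewrite trop_leM ?sqr3.
    apply: (@coefM_le _ _ _ _ 0 s _ _ i) => //.
      by apply: (@coefM_le _ _ _ _ 0 0 _ _ i).
    by apply: (@coefM_le _ _ _ _ 0 s _ _ i).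
Qed.

Lemma jump_poly_coef0 M : (jump_poly M)`_0 = loops M.
Proof. by rewrite coefD coefC coefMX /= addr0. Qed.

Lemma jump_poly_coef1 M : (jump_poly M)`_1 = jumps M.
Proof. by rewrite coefD coefC coefMX coefC /= add0r. Qed.

Lemma jump_poly_coef_ge2 M k : (jump_poly M)`_k.+2 = 0.
Proof. by rewrite coefD coefC coefMX coefC /= addr0. Qed.

Lemma jump_poly_coef0_diag M : coef0_diag (jump_poly M).
Proof. by move=> i j ij; rewrite jump_poly_coef0 mxE (negPf ij). Qed.

Lemma jump_poly_coef_le M k i j : ((jump_poly M)`_k i j <= M i j)%O.
Proof.
case: k => [|[|k]]; rewrite ?jump_poly_coef0 ?jump_poly_coef1 ?jump_poly_coef_ge2 !mxE.
- by case: eqP => // _; apply: trop_ge0.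
- by case: eqP => // _; apply: trop_ge0.
- exact: trop_ge0.
Qed.

Lemma prod_jump_poly_le (I : Type) (r : seq I) (f : I -> mx) k i j :
  ((\prod_(x <- r) jump_poly (f x))`_k i j <= (\prod_(x <- r) f x) i j)%O.
Proof.
elim: r k i j => [|x r IH] k i j.
  rewrite !big_nil coef1 !mxE; case: k => [|k] /=; first by rewrite mxE.
  by rewrite mxE trop_ge0.
rewrite !big_cons.
have [a [b [l [_ ->]]]] :=
  coefM_attained (jump_poly (f x)) (\prod_(x <- r) jump_poly (f x)) k i j.
apply: le_trans (le_mul_entry _ _ _ _ l).
by apply: trop_leM; [apply: jump_poly_coef_le|apply: IH].
Qed.

Lemma prod_jump_poly_coef0_diag (I : Type) (r : seq I) (f : I -> mx) :
  coef0_diag (\prod_(x <- r) jump_poly (f x)).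
Proof.
elim/big_ind: _ => [|A B|x _]; last exact: jump_poly_coef0_diag.
  by move=> i j ij; rewrite coef1 mxE (negPf ij).
exact: coef0_diagM.
Qed.

Definition njumps (v : nat -> 'I_n.+1) a b : nat := \sum_(a <= t < b) (v t != v t.+1).

Lemma njumps_cat v a b c : (a <= b)%N -> (b <= c)%N ->
  njumps v a c = (njumps v a b + njumps v b c)%N.
Proof. by move=> ab bc; rewrite /njumps (big_cat_nat ab bc). Qed.

Lemma eq_njumps v v' a b :
  (forall t, a <= t <= b -> v t = v' t)%N -> njumps v a b = njumps v' a b.
Proof.
move=> vv'; rewrite /njumps !big_nat; apply: eq_bigr => t /andP[at_ tb].
by rewrite !vv' ?at_ ?(ltnW tb) ?tb // leqW.
Qed.

Lemma walk_weight_le_njumps (F : nat -> mx) v s :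
  (walk_weight F v 0 s <=
     (\prod_(0 <= t < s) jump_poly (F t))`_(njumps v 0 s) (v 0%N) (v s))%O.
Proof.
elim: s => [|s IH].
  by rewrite /walk_weight /njumps !big_geq // coef1 mxE eqxx.
rewrite /walk_weight /njumps !(big_nat_recr s) //=.
apply: (coefM_le erefl IH).
have [e|ne] := eqVneq (v s) (v s.+1) => /=.
  by rewrite jump_poly_coef0 mxE e eqxx.
by rewrite jump_poly_coef1 mxE (negPf ne).
Qed.

(** The times followed by a jump, together with the final time, are more numerous
    than the vertices; between two of them at the same vertex there is a jump. *)
Lemma many_jumps_revisit v s : (n < njumps v 0 s)%N ->
  exists a b, [/\ (a < b)%N, (b <= s)%N, v a = v b & (0 < njumps v a b)%N].
Proof.
move=> many.
(* [t = s] is the final time, which no step follows *)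
pose A := [set t : 'I_s.+1 | (t == s :> nat) || (v t != v t.+1)].
have cardA : #|A| = (njumps v 0 s).+1.
  rewrite -sum1dep_card big_mkcond big_ord_recr /= eqxx addn1 /njumps big_mkord.
  by congr _.+1; apply: eq_bigr => t _; rewrite (ltn_eqF (ltn_ord t)); case: (_ != _).
have /dinjectivePn[x xA [y /andP[yx yA] vxy]] : ~~ dinjectiveb (fun t : 'I_s.+1 => v t) (mem A).
  apply/negP => /dinjectiveP inj.
  have := card_in_imset inj; rewrite cardA => e.
  by have := max_card (mem [set v t | t : 'I_s.+1 in A]); rewrite e card_ord; lia.
have main (a b : 'I_s.+1) : a \in A -> (a < b)%N -> v a = v b ->
    exists a b, [/\ (a < b)%N, (b <= s)%N, v a = v b & (0 < njumps v a b)%N].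
  move=> aA ab vab; exists a, b; split=> //; first by rewrite -ltnS.
  have as_ : (a < s)%N by apply: leq_trans ab _; rewrite -ltnS.
  rewrite (njumps_cat _ (leqnSn a) ab) addn_gt0 {1}/njumps big_nat1.
  by move: aA; rewrite inE (ltn_eqF as_) /= => ->.
have [xy|yx'|/val_inj e] := ltngtP x y.
- exact: main xA xy vxy.
- exact: main yA yx' (esym vxy).
- by rewrite e eqxx in yx.
Qed.

(** While there are more than [n] jumps, a closed part that contains a jump is
    replaced by loops. *)
Lemma few_jumps (F : nat -> mx) s :
  (forall a b k, (a < b)%N -> (b <= s)%N ->
     ((\prod_(a <= t < b) F t) k k <= \prod_(a <= t < b) F t k k)%O) ->
  forall v, exists v', [/\ v' 0%N = v 0%N, v' s = v s, (njumps v' 0 s <= n)%N &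
    (walk_weight F v 0 s <= walk_weight F v' 0 s)%O].
Proof.
move=> closed v; have [m] := ubnP (njumps v 0 s).
elim: m v => // m IH v; rewrite ltnS => vm.
have [few|/many_jumps_revisit[a [b [ab bs vab jab]]]] := leqP (njumps v 0 s) n.
  by exists v.
(* wait at the revisited vertex from time [a] to time [b] *)
pose v' t := if (a <= t <= b)%N then v a else v t.
have in_ab t : (a <= t <= b)%N -> v' t = v a by rewrite /v' => ->.
have before t : (0 <= t <= a)%N -> v t = v' t.
  rewrite /v' => /andP[_ ta]; case: ifP => // /andP[at_ _].
  by congr v; lia.
have after t : (b <= t <= s)%N -> v t = v' t.
  rewrite /v' => /andP[bt _]; case: ifP => // /andP[_ tb].
  by rewrite vab; congr v; lia.
have as_ : (a <= s)%N by lia.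
have vv0 := before 0%N isT; have vvs : v s = v' s by apply: after; rewrite bs leqnn.
have jv' : (njumps v' 0 s < njumps v 0 s)%N.
  rewrite !(njumps_cat _ (leq0n b) bs) !(njumps_cat _ (leq0n a) (ltnW ab)).
  have -> : njumps v' a b = 0%N.
    rewrite /njumps big_nat big1 // => t /andP[at_ tb].
    by rewrite !in_ab ?eqxx ?at_ ?tb ?(leqW at_) ?(ltnW tb).
  by rewrite (eq_njumps before) (eq_njumps after); lia.
have [v'' [e0 es few le]] := IH v' (leq_trans jv' vm).
exists v''; split; rewrite ?e0 ?es ?vv0 ?vvs //.
apply: le_trans le; rewrite !(walk_weight_cat _ _ (leq0n b) bs).
rewrite !(walk_weight_cat _ _ (leq0n a) (ltnW ab)).
rewrite -(eq_walk_weight _ before) -(eq_walk_weight _ after) !trop_leM //.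
apply: le_trans (walk_weight_le _ _ (ltnW ab)) _; rewrite -vab.
apply: le_trans (closed _ _ _ ab bs) _.
rewrite /walk_weight !big_nat le_eqVlt; apply/orP; left; apply/eqP/eq_bigr => t /andP[at_ tb].
by rewrite !in_ab ?at_ ?tb ?(leqW at_) ?(ltnW tb).
Qed.
End Jumps.

(** * Twin words *)

(** With [(u, v)] the previous pair, both words have the form [s w s] with
    [s = u v], and the middle word [w] is [u] or [v]. All the jumps of a walk that
    distinguishes them must lie in [w], but the two copies of [s] contain [u] and
    [v] on both sides. *)
Fixpoint twin m : seq bool * seq bool :=
  if m is m'.+1 then
    let: (u, v) := twin m' in (u ++ v ++ u ++ u ++ v, u ++ v ++ v ++ u ++ v)
  else ([:: true; false], [:: false; true]).

Lemma twin_size m : size (twin m).1 = size (twin m).2.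
Proof. by elim: m => //= m; case: (twin m) => u v /=; rewrite !size_cat; lia. Qed.

Lemma twin_neq m : (twin m).1 != (twin m).2.
Proof.
elim: m => //= m; have := twin_size m; case: (twin m) => u v /= size_uv.
by rewrite !eqseq_cat // !eqxx /= andbT.
Qed.

Section Twins.
Variables (R : realDomainType) (n : nat).
Local Notation mx := 'M[trop R]_n.+1.
Implicit Types f : bool -> mx.

Lemma twin_jump_poly f m k : (k <= m)%N ->
  (\prod_(x <- (twin m).1) jump_poly (f x))`_k =
  (\prod_(x <- (twin m).2) jump_poly (f x))`_k.
Proof.
elim: m k => [|m IH] k /=.
  rewrite leqn0 => /eqP->; rewrite !big_cons !big_nil !mulr1 !coef0M !jump_poly_coef0.
  apply/matrixP => i j; rewrite !mxE; apply: eq_bigr => l _; rewrite !mxE.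
  have [<-|_] := eqVneq i l; last by rewrite !mul0r.
  by have [<-|_] := eqVneq i j; rewrite ?mulr0 // mulrC.
case: (twin m) IH => u v /= IH km.
set A := \prod_(x <- u) jump_poly (f x) in IH *.
set B := \prod_(x <- v) jump_poly (f x) in IH *.
have dA : coef0_diag A := prod_jump_poly_coef0_diag _ _.
have dB : coef0_diag B := prod_jump_poly_coef0_diag _ _.
rewrite !big_cat /= -/A -/B !mulrA -!(mulrA _ A B).
apply: (@swap_in_context _ _ A B (fun i => A`_0 i i)) => // [i|l lk].
  by rewrite IH.
by apply: IH; apply: leq_trans lk km.
Qed.

(** Loops being the best closed walks, the walks of [u] are bounded by walks with
    at most [n] jumps, which are available in [v] too. *)
Lemma jump_polys_agree_le f (u v : seq bool) :
  (forall k, (k <= n)%N -> (\prod_(x <- u) jump_poly (f x))`_k =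
                           (\prod_(x <- v) jump_poly (f x))`_k) ->
  (forall (w : seq bool) k, (size w <= size u)%N ->
     ((\prod_(x <- w) f x) k k <= \prod_(x <- w) f x k k)%O) ->
  forall i j, ((\prod_(x <- u) f x) i j <= (\prod_(x <- v) f x) i j)%O.
Proof.
move=> uv closed i j; pose F t := f (nth true u t).
have [->|] := eqVneq ((\prod_(x <- u) f x) i j) 0; first exact: trop_ge0.
rewrite (big_nth true) => /(walk_attained (leq0n _))[v0 [vi vj ->]].
(* the factor of [u] between the positions [a] and [b] is itself a word *)
have closedF a b k : (a < b)%N -> (b <= size u)%N ->
    ((\prod_(a <= t < b) F t) k k <= \prod_(a <= t < b) F t k k)%O.
  move=> ab bu; pose w := take (b - a) (drop a u).
  have size_w : size w = (b - a)%N by rewrite size_takel ?size_drop; lia.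
  have nth_w t : (t < b - a)%N -> nth true w t = nth true u (t + a).
    by move=> tb; rewrite nth_take // nth_drop addnC.
  have := closed w k; rewrite size_w !(big_nth true) size_w.
  have -> : \prod_(a <= t < b) F t = \prod_(0 <= t < b - a) f (nth true w t).
    rewrite -{1}(add0n a) big_addn !big_nat; apply: eq_bigr => t /= tb.
    by rewrite nth_w.
  have -> : \prod_(a <= t < b) F t k k = \prod_(0 <= t < b - a) f (nth true w t) k k.
    rewrite -{1}(add0n a) big_addn !big_nat; apply: eq_bigr => t /= tb.
    by rewrite nth_w.
  by apply; lia.
have [v1 [e0 es few le]] := few_jumps closedF v0.
apply: le_trans le _; apply: le_trans (walk_weight_le_njumps _ _ _) _.
rewrite e0 es vi vj -(big_nth true xpredT (fun x => jump_poly (f x))) uv //.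
exact: prod_jump_poly_le.
Qed.
End Twins.

(** * The identity of tropical matrices *)

Definition subst_word (g : bool -> seq bool) (w : seq bool) : seq bool :=
  flatten [seq g x | x <- w].

Lemma size_subst_word g c w : (forall x, size (g x) = c) ->
  size (subst_word g w) = (size w * c)%N.
Proof. by move=> gc; elim: w => //= x w IH; rewrite size_cat gc IH. Qed.

Lemma subst_word_inj g u v : size (g true) = size (g false) -> g true != g false ->
  size u = size v -> subst_word g u = subst_word g v -> u = v.
Proof.
move=> sg gtf; elim: u v => [|x u IH] [|y v] //= [suv] /eqP.
have sgxy : size (g x) = size (g y) by case: x y => [] [].
rewrite /subst_word /= eqseq_cat // => /andP[/eqP gxy /eqP /(IH _ suv) ->].
by congr (_ :: _); case: x y gxy {sgxy} => [] [] // gxy; move: gtf; rewrite gxy eqxx.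
Qed.

Lemma prod_subst_word (K : pzSemiRingType) (f : bool -> K) g w :
  \prod_(x <- subst_word g w) f x = \prod_(y <- w) \prod_(x <- g y) f x.
Proof. by rewrite big_flatten big_map. Qed.

Lemma prod_nseq (K : pzSemiRingType) (f : bool -> K) N x :
  \prod_(y <- nseq N x) f y = f x ^+ N.
Proof. by rewrite big_nseq iter_mulr_1. Qed.

Lemma prod_flatten_nseq (K : pzSemiRingType) (f : bool -> K) N w :
  \prod_(x <- flatten (nseq N w)) f x = (\prod_(x <- w) f x) ^+ N.
Proof. by rewrite big_flatten big_nseq iter_mulr_1. Qed.

Fixpoint words_upto L : seq (seq bool) :=
  if L is L'.+1 then
    [::] :: [seq true :: w | w <- words_upto L'] ++
            [seq false :: w | w <- words_upto L']
  else [:: [::]].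

Lemma mem_words_upto L w : (size w <= L)%N -> w \in words_upto L.
Proof.
elim: L w => [|L IH] [|x w] //= wL; rewrite inE mem_cat; apply/orP.
by right; apply/orP; case: x; [left|right]; apply/mapP; exists w => //; apply: IH.
Qed.

Section Slide.
Variables (K : pzSemiRingType) (m n : nat) (X : 'M[K]_(m, n)) (Y : 'M[K]_(n, m)).

(** Rotating the product moves the factorisation [X *m Y] between the letters and
    leaves matrices of size [n]. *)
Lemma prod_slide (M : bool -> 'M[K]_m) (u : seq bool) :
  (X *m Y) * \prod_(x <- u) (M x * (X *m Y)) =
  X *m (\prod_(x <- u) (Y *m M x *m X) : 'M_n) *m Y.
Proof.
elim: u => [|x u IH]; first by rewrite !big_nil mulr1 mulmx1.
rewrite !big_cons -mulrA IH -!mulmxE !mulmxA //.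
Qed.
End Slide.

Definition factors_through (K : pzSemiRingType) m n (A : 'M[K]_m) : Prop :=
  exists (X : 'M_(m, n)) (Y : 'M_(n, m)), A = X *m Y.

Lemma factors_through_prod (K : pzSemiRingType) m n (I : eqType) (r : seq I)
    (F : I -> 'M[K]_m) c :
  c \in r -> factors_through n (F c) -> factors_through n (\prod_(x <- r) F x).
Proof.
case/splitPr => r1 r2 [X [Y e]]; rewrite big_cat big_cons /= e.
exists ((\prod_(x <- r1) F x) *m X), (Y *m (\prod_(x <- r2) F x)).
by rewrite -!mulmxE !mulmxA.
Qed.

Lemma rigid_le (R : realDomainType) n (Z : 'M[trop R]_n) K L :
  (L <= K)%N -> rigid Z K -> rigid Z L.
Proof.
move=> LK rig k; have [Zk0 str] := rig k; split=> // q r y yk qrL.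
by apply: str => //; apply: leq_trans LK.
Qed.

Lemma twin_eval (R : realDomainType) n (f : bool -> 'M[trop R]_n.+1) N :
  (0 < N)%N ->
  (forall x, rigid (f x) (n.+1)`!) ->
  (forall w, (size w <= size (twin n).1)%N -> rigid ((\prod_(x <- w) f x) ^+ N) 2) ->
  \prod_(x <- (twin n).1) f x = \prod_(x <- (twin n).2) f x.
Proof.
move=> N0 rigf rigw.
have closed w k : (size w <= size (twin n).1)%N ->
    ((\prod_(x <- w) f x) k k <= \prod_(x <- w) f x k k)%O.
  move=> /rigw rigN; apply: (word_diag_additive N0 _ _ rigN) => x.
    exact: rigid_perm_dominated (leqnn _) (rigf x).
  by move=> l; case: (rigf x l).
apply/matrixP => i j; apply: le_anti; apply/andP; split.
  by apply: jump_polys_agree_le closed _ _ => k kn; apply: twin_jump_poly.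
apply: jump_polys_agree_le => [k kn|w k]; first by rewrite twin_jump_poly.
by rewrite -twin_size; apply: closed.
Qed.

(** The substituted letters [g true] and [g false] end in [W], a product of powers
    of all the words [C] that the dichotomy is applied to. They differ because the
    twin words do, so the substitution is injective. *)
Theorem trop_matrix_identity (R : realDomainType) n : exists u v : seq bool,
  [/\ u != v, size u = size v &
    forall f : bool -> 'M[trop R]_n, \prod_(x <- u) f x = \prod_(x <- v) f x].
Proof.
elim: n => [|n [u [v [uv suv idn]]]].
  by exists [:: true; false], [:: false; true]; split=> // f; apply/matrixP => -[].
(* permutations need rigidity up to [m`!] steps, exchanges of two walks up to 2 *)
set m := n.+1; pose N := m`!; pose K := N.+1.
pose s := let h := ((m * (N * K)).+1 * m + N * K)%N in (h + h)%N.
pose p := (twin n).1; pose q := (twin n).2.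
pose power w := subst_word (nseq N) w.
pose C := [:: [:: true]; [:: false]] ++ [seq power w | w <- words_upto (size p)].
pose W := flatten [seq flatten (nseq s c) | c <- C].
pose g (x : bool) := power (if x then p else q) ++ W.
exists (W ++ subst_word g u), (W ++ subst_word g v).
have N0 : (0 < N)%N := fact_gt0 m.
have sizeN (x : bool) : size (nseq N x) = N by rewrite size_nseq.
have size_g : size (g true) = size (g false).
  by rewrite !size_cat !(size_subst_word _ sizeN) /p twin_size.
have g_neq : g true != g false.
  rewrite /g eqseq_cat ?(size_subst_word _ sizeN) /p ?twin_size // eqxx andbT.
  apply: contra_neq (twin_neq n) => /subst_word_inj; apply; rewrite ?size_nseq ?twin_size //.
  by rewrite -(prednK N0).
have sgx x : size (g x) = size (g true) by case: x.
split.
- apply: contra_neq uv => /eqP; rewrite eqseq_cat // eqxx /= => /eqP.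
  exact: subst_word_inj.
- by rewrite !size_cat !(size_subst_word _ sgx) suv.
move=> f.
pose ev w := \prod_(x <- w) f x.
have evW : ev W = \prod_(c <- C) (ev c) ^+ s.
  rewrite /ev /W big_flatten big_map; apply: eq_bigr => c _.
  exact: prod_flatten_nseq.
pose M (x : bool) := ev (power (if x then p else q)).
have ev_subst w : \prod_(x <- W ++ subst_word g w) f x =
    ev W * \prod_(y <- w) (M y * ev W).
  rewrite big_cat prod_subst_word /=; congr (_ * _).
  by apply: eq_bigr => y _; rewrite big_cat.
rewrite !ev_subst.
(* either some power factors, and so does [ev W], or all words are rigid *)
have [[c cC fac]|nofac] := boolp.EM (exists2 c, c \in C & factors_through n (ev c ^+ s)).
  have [X [Y eW]] := factors_through_prod (F := fun c => ev c ^+ s) cC fac.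
  rewrite -evW in eW; rewrite eW.
  apply: etrans (prod_slide X Y M u) _.
  by rewrite idn; apply: esym (prod_slide X Y M v).
have rig c : c \in C -> rigid (ev c ^+ N) K.
  move=> cC; have dvdN (l : 'I_m) : (l.+1 %| N)%N by rewrite dvdn_fact /= ?ltn_ord.
  have [fac|//] := power_factors_or_rigid (ev c) dvdN N0 (ltn0Sn N).
  by case: nofac; exists c.
have rigx x : rigid (f x ^+ N) N.
  apply: (@rigid_le _ _ _ K) => //; have := rig [:: x].
  by rewrite /ev big_seq1; apply; rewrite mem_cat !inE; case: x.
have ev_power w : ev (power w) = \prod_(x <- w) (f x ^+ N).
  by rewrite /ev prod_subst_word; apply: eq_bigr => x _; rewrite prod_nseq.
have ev_pq : ev (power p) = ev (power q).
  rewrite !ev_power; apply: (@twin_eval _ _ (fun x => f x ^+ N) N) => // w wp.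
  rewrite -ev_power; apply: (@rigid_le _ _ _ K); first by rewrite ltnS.
  by apply: rig; rewrite mem_cat; apply/orP; right; apply: map_f; apply: mem_words_upto.
have Mconst w : \prod_(y <- w) (M y * ev W) = (M true * ev W) ^+ size w.
  rewrite (eq_bigr (fun=> M true * ev W)); last by rewrite /M => -[]; rewrite ?ev_pq.
  by rewrite big_const_seq count_predT iter_mulr_1.
by rewrite !Mconst suv.
Qed.

(** * From supertropical to tropical matrices *)

Section Value.
Variable R : realDomainType.
Implicit Types x y : supertropical R.

Definition st_val x : trop R :=
  match x with NegInf => None | Tangible a | Ghost a => Some a end.

Definition tangible x : bool := if x is Tangible _ then true else false.

Lemma st_val_inj x y : st_val x = st_val y -> tangible x = tangible y -> x = y.
Proof. by case: x y => [|a|a] [|b|b] //= [->]. Qed.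

Lemma st_valM x y : st_val (x * y) = st_val x * st_val y.
Proof. by case: x y => [|a|a] [|b|b]. Qed.

Lemma tangibleM x y : tangible (x * y) = tangible x && tangible y.
Proof. by case: x y => [|a|a] [|b|b]. Qed.

Lemma nu_lt_val x y : (nu x < nu y)%O = (st_val x < st_val y)%O.
Proof. by rewrite !ltNge; case: x y => [|a|a] [|b|b]. Qed.

Lemma st_addE x y : x + y =
  if (st_val x < st_val y)%O then y else if (st_val y < st_val x)%O then x else nu x.
Proof. by rewrite -!nu_lt_val -supertropical_addE. Qed.

Lemma st_val_nu x : st_val (nu x) = st_val x.
Proof. by case: x. Qed.

Lemma st_valD x y : st_val (x + y) = st_val x + st_val y.
Proof. by rewrite st_addE trop_addE; case: ltgtP => //; rewrite st_val_nu. Qed.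

Lemma tangible_nu x : tangible (nu x) = false.
Proof. by case: x. Qed.

Lemma st_val_sum (I : Type) (r : seq I) (P : pred I) (F : I -> supertropical R) :
  st_val (\sum_(i <- r | P i) F i) = \sum_(i <- r | P i) st_val (F i).
Proof. exact: (big_morph st_val st_valD). Qed.

Lemma tangible_neq0 x : tangible x -> st_val x != 0.
Proof. by case: x. Qed.

(** Two maximal terms add up to a ghost, and a ghost that is maximal absorbs all
    other terms. *)
Lemma tangible_sumP (I : finType) (F : I -> supertropical R) (i0 : I) :
  reflect (exists2 k, tangible (F k) & forall l, l != k -> (st_val (F l) < st_val (F k))%O)
    (tangible (\sum_i F i)).
Proof.
apply: (iffP idP) => [tan|[k tank max_k]]; last first.
  rewrite (bigD1 k) //= st_addE ltNge ltW /= st_val_sum.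
    by rewrite trop_sum_lt // tangible_neq0.
  by rewrite trop_sum_lt // tangible_neq0.
have [k ek] := trop_sum_attained (st_val \o F) i0.
have rest_lt : (st_val (\sum_(i | i != k) F i) < st_val (F k))%O.
  move: tan; rewrite (bigD1 k) //= st_addE.
  rewrite ltNge.
  have -> /= : (st_val (\sum_(i | i != k) F i) <= st_val (F k))%O.
    by rewrite st_val_sum -[leRHS]ek trop_sum_le // => i _; apply: (trop_le_sum (st_val \o F)).
  by case: ifP => // _; rewrite tangible_nu.
exists k => [|l lk].
  by move: tan; rewrite (bigD1 k) //= st_addE (lt_gtF rest_lt) rest_lt.
apply: le_lt_trans rest_lt; rewrite st_val_sum (bigD1 l) //= trop_addE.
by rewrite le_max lexx.
Qed.

End Value.

Section WalkPairs.
Variables (R : realDomainType) (n : nat).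
Notation I := ('I_n + 'I_n * 'I_n)%type.
Notation st_mx := 'M[supertropical R]_n.
Notation pair_mx := 'M[trop R]_#|{: I}|.
Implicit Types (A : st_mx) (B : pair_mx).

Definition entry B (x y : I) : trop R := B (enum_rank x) (enum_rank y).

(** [B] records the largest total weights of two walks with the arcs of [A]: in a
    state [inl i] both are at [i] and have been equal so far, in a state
    [inr (i, j)] they are at [i] and at [j] and have parted. Two walks that part
    and end in [j] are lighter than twice the optimum exactly if the optimal walk
    is unique and tangible; a ghost arc counts as two parallel arcs. *)
Record walk_pairs A B : Prop := WalkPairs {
  pairs_same i j : entry B (inl i) (inl j) = st_val (A i j) ^+ 2;
  pairs_merge p i : entry B (inr p) (inl i) = 0;
  pairs_split p q :
    entry B (inr p) (inr q) = st_val (A p.1 q.1) * st_val (A p.2 q.2);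
  pairs_leave i j k : j != k ->
    entry B (inl i) (inr (j, k)) = st_val (A i j) * st_val (A i k);
  pairs_double_le i j : (entry B (inl i) (inr (j, j)) <= st_val (A i j) ^+ 2)%O;
  pairs_double_lt i j :
    (entry B (inl i) (inr (j, j)) < st_val (A i j) ^+ 2)%O = tangible (A i j) }.

Definition pair_matrix A : pair_mx :=
  \matrix_(s, t) match enum_val s, enum_val t with
    | inl i, inl j => st_val (A i j) ^+ 2
    | inr _, inl _ => 0
    | inr p, inr q => st_val (A p.1 q.1) * st_val (A p.2 q.2)
    | inl i, inr (j, k) =>
        if (j == k) && tangible (A i j) then 0 else st_val (A i j) * st_val (A i k)
    end.

Lemma pair_matrixP A : walk_pairs A (pair_matrix A).
Proof.
split=> [i j|p i|p q|i j k jk|i j|i j]; rewrite /entry mxE !enum_rankK //.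
- by rewrite (negPf jk).
- by rewrite eqxx; case: ifP; rewrite ?trop_ge0 // expr2.
- rewrite eqxx /=; case tan: (tangible _); last by rewrite expr2 ltxx.
  by rewrite trop_gt0 trop_expf_neq0 // tangible_neq0.
Qed.

Lemma walk_pairs_inj A A' B : walk_pairs A B -> walk_pairs A' B -> A = A'.
Proof.
move=> AB AB'; apply/matrixP => i j.
have vv : st_val (A i j) = st_val (A' i j).
  have e : st_val (A i j) ^+ 2 = st_val (A' i j) ^+ 2.
    by rewrite -(pairs_same AB) (pairs_same AB').
  by apply: le_anti; apply/andP; split; apply: (@trop_leX2 _ _ _ 2); rewrite ?e.
by apply: st_val_inj => //; rewrite -(pairs_double_lt AB) -(pairs_double_lt AB') vv.
Qed.

Lemma entryM B B' x y : entry (B * B') x y =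
  \sum_i entry B x (inl i) * entry B' (inl i) y +
  \sum_p entry B x (inr p) * entry B' (inr p) y.
Proof.
rewrite /entry mxE (reindex (@enum_rank I)) ?big_sumType //.
exact: onW_bij (@enum_rank_bij I).
Qed.

Lemma pairs_leave_le A B i j k : walk_pairs A B ->
  (entry B (inl i) (inr (j, k)) <= st_val (A i j) * st_val (A i k))%O.
Proof.
move=> AB; have [->|jk] := eqVneq j k; last by rewrite (pairs_leave AB).
by rewrite -expr2 (pairs_double_le AB).
Qed.

Lemma st_val_mul A A' i j : st_val ((A * A') i j) = \sum_k st_val (A i k) * st_val (A' k j).
Proof. by rewrite mxE st_val_sum; apply: eq_bigr => k _; rewrite st_valM. Qed.

Section Product.
Variables (A A' : st_mx) (B B' : pair_mx).
Hypotheses (AB : walk_pairs A B) (AB' : walk_pairs A' B').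

Lemma entryM_leave_le i j k : (entry (B * B') (inl i) (inr (j, k)) <=
  st_val ((A * A') i j) * st_val ((A * A') i k))%O.
Proof.
rewrite entryM trop_addE ge_max !st_val_mul; apply/andP; split; apply: trop_sum_le.
  move=> l _; rewrite (pairs_same AB).
  apply: le_trans (trop_leM (trop_le_sum _ l) (trop_le_sum _ l)).
  rewrite mulrACA -expr2 trop_leM //; exact: pairs_leave_le.
move=> [a b] _; rewrite (pairs_split AB') /=.
apply: le_trans (trop_leM (trop_le_sum _ a) (trop_le_sum _ b)).
rewrite mulrACA trop_leM //; exact: pairs_leave_le.
Qed.

Lemma entryM_leave i j k : j != k -> entry (B * B') (inl i) (inr (j, k)) =
  st_val ((A * A') i j) * st_val ((A * A') i k).
Proof.
move=> jk; apply: le_anti; rewrite entryM_leave_le /= !st_val_mul.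
have [a ->] := trop_sum_attained (fun l => st_val (A i l) * st_val (A' l j)) i.
have [b ->] := trop_sum_attained (fun l => st_val (A i l) * st_val (A' l k)) i.
rewrite mulrACA entryM trop_addE le_max; apply/orP.
have [<-|ab] := eqVneq a b; [left|right].
  apply: le_trans (trop_le_sum _ a) => /=.
  by rewrite (pairs_same AB) (pairs_leave AB') // expr2.
apply: le_trans (trop_le_sum _ (a, b)) => /=.
by rewrite (pairs_leave AB) // (pairs_split AB').
Qed.

(** Two distinct walks through [k] and [l] reach twice the optimum in three ways:
    with [k = l] and two walks in the first factor or in the second one, or with
    [k <> l] and both terms optimal. These are the ways in which the sum over the
    middle vertex fails to be tangible. *)
Lemma entryM_double_lt i j : (entry (B * B') (inl i) (inr (j, j)) <
  st_val ((A * A') i j) ^+ 2)%O = tangible ((A * A') i j).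
Proof.
pose t k := st_val (A i k) * st_val (A' k j).
have tE k : st_val (A i k * A' k j) = t k by rewrite st_valM.
rewrite st_val_mul -/t [(A * A') i j]mxE; apply/idP/(tangible_sumP _ i).
  have [k ek] := trop_sum_attained t i.
  rewrite -[\sum_k _]/(\sum_k t k) ek => lt.
  have sum_lt z : (entry B (inl i) z * entry B' z (inr (j, j)) < t k ^+ 2)%O.
    apply: le_lt_trans lt; rewrite entryM trop_addE le_max; apply/orP.
    by case: z => z; [left|right]; apply: le_trans (trop_le_sum _ z).
  have double (x y : trop R) : (x * y) ^+ 2 = x ^+ 2 * y ^+ 2 by ring.
  exists k => [|l lk]; rewrite ?tE.
    rewrite tangibleM -(pairs_double_lt AB) -(pairs_double_lt AB') !ltNge -negb_or.
    apply/negP => /orP[] le.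
      have := sum_lt (inr (k, k)); rewrite (pairs_split AB') /= -expr2 ltNge double.
      by rewrite trop_leM.
    have := sum_lt (inl k); rewrite (pairs_same AB) ltNge double.
    by rewrite trop_leM.
  rewrite ltNge; apply/negP => le.
  have := sum_lt (inr (k, l)); rewrite (pairs_leave AB) 1?eq_sym //.
  by rewrite (pairs_split AB') /= mulrACA ltNge expr2 trop_leM.
case=> k; rewrite tangibleM => /andP[tA tA'] max_k.
have vA := tangible_neq0 tA; have vA' := tangible_neq0 tA'.
have tk0 : t k != 0 by rewrite trop_mul_eq0 negb_or vA.
have lt_t l : l != k -> (t l < t k)%O by move=> lk; rewrite -!tE max_k.
have le_t l : (t l <= t k)%O by have [->//|/lt_t/ltW] := eqVneq l k.
have -> : \sum_k t k = t k.
  by apply: le_anti; rewrite trop_sum_le // (trop_le_sum t).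
have tt0 : t k ^+ 2 != 0 by apply: trop_expf_neq0.
have double (x y : trop R) : (x * y) ^+ 2 = x ^+ 2 * y ^+ 2 by ring.
rewrite entryM trop_addE gt_max; apply/andP; split; apply: trop_sum_lt => //.
  move=> l _; rewrite (pairs_same AB).
  have [->|/lt_t lk] := eqVneq l k.
    by rewrite double trop_ltM2l ?trop_expf_neq0 // (pairs_double_lt AB').
  apply: le_lt_trans (trop_ltX lk (isT : 0 < 2)%N); rewrite double trop_leM //.
  exact: pairs_double_le.
move=> [a b] _; rewrite (pairs_split AB') /=.
have [->|ak] := eqVneq a k; have [->|bk] := eqVneq b k.
- rewrite -expr2 double ![_ * st_val (A' k j) ^+ 2]mulrC.
  by rewrite trop_ltM2l ?trop_expf_neq0 // (pairs_double_lt AB).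
- apply: (@le_lt_trans _ _ (t k * t b)).
    by rewrite mulrACA trop_leM // pairs_leave_le.
  by rewrite expr2 trop_ltM2l // lt_t.
- apply: (@le_lt_trans _ _ (t a * t k)).
    by rewrite mulrACA trop_leM // pairs_leave_le.
  by rewrite expr2 mulrC trop_ltM2l // lt_t.
- apply: (@le_lt_trans _ _ (t a * t b)).
    by rewrite mulrACA trop_leM // pairs_leave_le.
  by rewrite expr2 trop_lt_leM // lt_t.
Qed.

Lemma walk_pairsM : walk_pairs (A * A') (B * B').
Proof.
split=> [i j|p i|p q|i j k|i j|i j].
- rewrite entryM [X in _ + X]big1 ?addr0; last by move=> p _; rewrite (pairs_merge AB') mulr0.
  rewrite st_val_mul trop_sum_sqr; apply: eq_bigr => k _.
  by rewrite (pairs_same AB) (pairs_same AB'); ring.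
- rewrite entryM !big1 ?addr0 // => k _; first by rewrite (pairs_merge AB') mulr0.
  by rewrite (pairs_merge AB) mul0r.
- rewrite entryM big1 ?add0r; last by move=> k _; rewrite (pairs_merge AB) mul0r.
  rewrite !st_val_mul big_distrlr pair_big /=; apply: eq_bigr => r _.
  by rewrite (pairs_split AB) (pairs_split AB') mulrACA.
- exact: entryM_leave.
- by rewrite expr2; apply: entryM_leave_le.
- exact: entryM_double_lt.
Qed.

End Product.

Lemma walk_pairs_prod (A : bool -> st_mx) (w : seq bool) : w != [::] ->
  walk_pairs (\prod_(x <- w) A x) (\prod_(x <- w) pair_matrix (A x)).
Proof.
elim: w => [//|x [|y w] IH] _; first by rewrite !big_seq1; apply: pair_matrixP.
by rewrite !(big_cons _ _ x); apply: walk_pairsM (pair_matrixP _) (IH _).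
Qed.
End WalkPairs.

Theorem st_matrix_identity (R : realDomainType) n : exists u v : word, u <> v /\
  forall A : bool -> 'M[supertropical R]_n,
    \prod_(x <- word_seq u) A x = \prod_(x <- word_seq v) A x.
Proof.
have [u [v [uv suv id]]] := trop_matrix_identity R #|{: 'I_n + 'I_n * 'I_n}|.
have nonempty (w w' : seq bool) : w != w' -> size w = size w' -> w != [::].
  by case: w => //; case: w'.
have u0 := nonempty _ _ uv suv.
have v0 : v != [::] by apply: (nonempty v u); rewrite // eq_sym.
exists (Word u0), (Word v0); split=> [[/eqP]|A /=]; first by rewrite (negPf uv).
apply: (walk_pairs_inj (walk_pairs_prod A u0)); rewrite id.
exact: walk_pairs_prod.
Qed.

Definition letter (x : bool) : word := Word (isT : [:: x] != [::]).

Lemma prod_letters (K : pzSemiRingType) (psi : word -> K) :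
  (forall u v, psi (word_cat u v) = psi u * psi v) ->
  forall w, psi w = \prod_(x <- word_seq w) psi (letter x).
Proof.
move=> psiM [w]; elim: w => [//|x [|y w] IH] w0.
  by rewrite big_seq1; congr psi; apply: val_inj.
have -> : Word w0 = word_cat (letter x) (Word (isT : y :: w != [::])).
  exact: val_inj.
by rewrite psiM IH [RHS]big_cons.
Qed.

Local Close Scope ring_scope.
Unset Implicit Arguments.

Theorem corollary3p6 (R : realType) (n : nat) (hn : 0 < n) (S : semigroupType)
    (hrho : exists rho : {multiplicative S -> matrix_monoid (supertropical R) n},
      injective rho) :
  exists u v : word, u <> v /\ satisfies_identity S u v.
Proof.
have [rho rho_inj] := hrho.
have [u [v [uv id]]] := st_matrix_identity R n.
exists u, v; split=> // phi; apply: rho_inj.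
have psiM w1 w2 :
    (rho (phi (word_cat w1 w2)) = (rho (phi w1) : 'M_n) * rho (phi w2) :> 'M_n)%R.
  by rewrite -[word_cat _ _]/(w1 * w2)%g !gmulfM.
by rewrite !(prod_letters (psi := fun w => rho (phi w) : 'M_n) psiM).
Qed.
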